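(* For every integer $k\ge 0$ and every $\alpha\in\{1,\dots,N\}$, \begin{align*} 24\gamma_{\alpha}\Phi_{k} ={}&-\sum_{i=1}^{k-1}\langle\langle G(E^i)\{E^{k-i-1}\circ\gamma_{\alpha}\}\gamma_{\mu}\gamma^{\mu}\rangle\rangle_{0} -\sum_{i=0}^{k-2}(k-i-1)\langle\langle \{G(E^i)\circ E^{k-i-2}\}\Delta\gamma_{\alpha}\rangle\rangle_{0}\\ &+\sum_{i=0}^{k-2}(-k+2i+2)\langle\langle G(\Delta\circ E^{k-i-2})E^i\gamma_{\alpha}\rangle\rangle_{0}\\ &-\sum_{i=1}^{k-1}\sum_{j=1}^{i}\langle\langle G(E^{k-i-1}\circ\Delta) G(E^{i-j}\circ\gamma_{\alpha}) E^{j-1}\rangle\rangle_{0}\\ &-\sum_{i=1}^{k-1}\sum_{j=1}^{i}\langle\langle \{G(E^{k-i-1})\circ \Delta\}G(E^{i-j}\circ\gamma_{\alpha}) E^{j-1}\rangle\rangle_{0}\\ &+12\sum_{i=1}^{k-1}i\,\langle\langle \{G(E^{k-i-1}\circ \gamma^{\mu})\circ G(\gamma_{\mu})\}E^{i-1}\gamma_{\alpha}\rangle\rangle_{0} -k(k-1)\langle\langle \Delta E^{k-2}\gamma_{\alpha}\rangle\rangle_{0}. \end{align*}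
   Context: Setting. Let $X$ be a smooth complex projective variety of dimension $d$ with $H^{odd}(X;\mathbb{C})=0$. Fix a basis $\gamma_1,\dots,\gamma_N$ of $H^*(X,\mathbb{C})$ with $\gamma_1$ the identity of the cohomology ring and $\gamma_\alpha\in H^{p_\alpha,q_\alpha}(X,\mathbb{C})$. Put $\eta_{\alpha\beta}=\int_X\gamma_\alpha\cup\gamma_\beta$, $(\eta^{\alpha\beta})=(\eta_{\alpha\beta})^{-1}$, $\gamma^\alpha=\sum_\mu\eta^{\mu\alpha}\gamma_\mu$, and $b_\alpha=p_\alpha-\frac12(d-1)$. Primary Gromov-Witten invariants are $\langle\tilde\gamma_1\cdots\tilde\gamma_k\rangle_g=\sum_{\Lambda\in H_2(X,\mathbb{Z})}q^\Lambda\int_{[\overline{\mathcal M}_{g,k}(X,\Lambda)]^{vir}}\prod_i \mathbf{ev}_i^*(\tilde\gamma_i)$, with $q^\Lambda$ in the Novikov ring. The small phase space is $H^*(X,\mathbb{C})$ with coordinates $t^1,\dots,t^N$, and $\gamma_\alpha$ is identified with the vector field $\partial/\partial t^\alpha$. Let $F_g(t)=\sum_{k\ge0}\frac1{k!}\sum_{\alpha_1,\dots,\alpha_k}t^{\alpha_1}\cdots t^{\alpha_k}\langle\gamma_{\alpha_1}\cdots\gamma_{\alpha_k}\rangle_g$ (unstable terms being zero). For vector fields $v_i=\sum_\alpha f^i_\alpha\gamma_\alpha$ (coefficients functions of $t$) put $\langle\langle v_1\cdots v_k\rangle\rangle_g=\sum f^1_{\alpha_1}\cdots f^k_{\alpha_k}\,\partial^kF_g/\partial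 t^{\alpha_1}\cdots\partial t^{\alpha_k}$. Braces $\{\cdot\}$ only delimit a single vector field. For a vector field $v$ and a function $f$ of $t$, $v f$ is the directional derivative of $f$ along $v$. Quantum product: $v\circ w=\sum_\alpha\langle\langle v\,w\,\gamma^\alpha\rangle\rangle_0\gamma_\alpha$ (commutative, associative, with identity $\gamma_1$). $G(\sum_\alpha f_\alpha\gamma_\alpha)=\sum_\alpha b_\alpha f_\alpha\gamma_\alpha$. $\Delta=\sum_\alpha\gamma^\alpha\circ\gamma_\alpha$. Euler vector field: $E=c_1(X)+\sum_\alpha(b_1+1-b_\alpha)t^\alpha\gamma_\alpha$; $E^k$ is its $k$-th quantum power, $E^0=\gamma_1$. Conventions. An index occurring in a term both as a superscript and as a subscript on $\gamma$'s is summed from $1$ to $N$. Empty sums are zero, and a term with zero numerical coefficient is zero (even if it formally contains a negative power of $E$). The functions $\Phi_k$: $\Phi_0=0$, $\Phi_1=-\frac1{24}\int_Xc_1(X)\cup c_{d-1}(X)$, and for $k\ge2$ $$\Phi_k=-\tfrac1{24}\sum_{m=0}^{k-1}\sum_{\alpha,\beta,\sigma}b_\alpha\langle\langle\gamma_1E^m\gamma^\alpha\rangle\rangle_0\langle\langle\gamma_\alpha E^{k-1-m}\gamma^\beta\rangle\rangle_0\langle\langle\gamma_\beta\gamma_\sigma\gamma^\sigma\rangle\rangle_0-\tfrac14\sum_{m=0}^{k-1}\sum_{\alpha,\beta}b_\alpha b_\beta\langle\langle\gamma_\alpha E^m\gamma^\beta\rangle\rangle_0\langle\langle\gamma_\beta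 E^{k-1-m}\gamma^\alpha\rangle\rangle_0+\tfrac k{12}\sum_\sigma\langle\langle\gamma_\sigma E^{k-1}\gamma^\sigma\rangle\rangle_0$$ (the same formula also holds for $k=0,1$). *)

(* Defs.v *)
From HB Require Import structures.
From mathcomp Require Import all_boot all_order all_algebra all_field.
From mathcomp Require Import boolp reals complex.
Set Implicit Arguments.
Unset Strict Implicit.
Unset Printing Implicit Defensive.
Import GRing.Theory.
Local Open Scope ring_scope.

(* Commutative monoids in which every element is a sum of two elements in only
   finitely many ways.  These are the exponent monoids for which all functions
   M -> A form a ring under convolution.                                      *)
HB.mixin Record Nmodule_hasSplits M of GRing.Nmodule M := {
  splits : M -> seq (M * M);
  splits_uniq : forall m, uniq (splits m);
  mem_splits : forall m p, (p \in splits m) = (p.1 + p.2 == m)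
}.

#[short(type="splitNmodType")]
HB.structure Definition SplitNmodule :=
  { M of GRing.Nmodule M & Nmodule_hasSplits M }.

(* f : series M A stands for the formal sum of the f m * x^m over all m : M.  *)
Definition series (M : splitNmodType) (A : comNzRingType) : Type := M -> A.

Section SeriesRing.
Variables (M : splitNmodType) (A : comNzRingType).
Implicit Types (f g h : series M A) (m : M).

HB.instance Definition _ := gen_eqMixin (series M A).
HB.instance Definition _ := gen_choiceMixin (series M A).

Definition series_zero : series M A := fun=> 0.
Definition series_opp f : series M A := fun m => - f m.
Definition series_add f g : series M A := fun m => f m + g m.
Definition series_const (a : A) : series M A :=
  fun m => if m == 0 then a else 0.
Definition series_mul f g : series M A :=
  fun m => \sum_(u <- splits m) f u.1 * g u.2.

Fact series_addA : associative series_add.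
Proof. by move=> f g h; apply/funext => m; rewrite /series_add addrA. Qed.
Fact series_addC : commutative series_add.
Proof. by move=> f g; apply/funext => m; rewrite /series_add addrC. Qed.
Fact series_add0 : left_id series_zero series_add.
Proof. by move=> f; apply/funext => m; rewrite /series_add add0r. Qed.
Fact series_addN : left_inverse series_zero series_opp series_add.
Proof. by move=> f; apply/funext => m; rewrite /series_add addNr. Qed.

HB.instance Definition _ := GRing.isZmodule.Build (series M A)
  series_addA series_addC series_add0 series_addN.

Fact series_mulC : commutative series_mul.
Proof.
move=> f g; apply/funext => m; rewrite /series_mul.
have sw : perm_eq (splits m) [seq (u.2, u.1) | u <- splits m].
  apply: uniq_perm; first exact: splits_uniq.
    by rewrite map_inj_uniq ?splits_uniq// => -[a b] [c d] [-> ->].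
  move=> [a b]; rewrite mem_splits /=; apply/eqP/mapP => [<-|[[c d]]].
    by exists (b, a); rewrite // mem_splits /= addrC.
  by rewrite mem_splits => /eqP/= <- [-> ->]; rewrite addrC.
by rewrite (perm_big _ sw) big_map; apply: eq_bigr => u _; rewrite mulrC.
Qed.

Fact series_mulA : associative series_mul.
Proof.
move=> f g h; apply/funext => m; rewrite /series_mul.
under eq_bigr do rewrite mulr_sumr.
under [RHS]eq_bigr do rewrite mulr_suml.
pose l3 := [seq (u, v) | u <- splits m, v <- splits u.2].
pose r3 := [seq (u, v) | u <- splits m, v <- splits u.1].
pose F (w : (M * M) * (M * M)) := f w.1.1 * (g w.2.1 * h w.2.2).
pose K (w : (M * M) * (M * M)) := f w.2.1 * g w.2.2 * h w.1.2.
transitivity (\sum_(w <- l3) F w); first by rewrite big_allpairs_dep.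
transitivity (\sum_(w <- r3) K w); last by rewrite big_allpairs_dep.
pose t (w : (M * M) * (M * M)) := ((w.2.1, w.2.2 + w.1.2), (w.2.2, w.1.2)).
have ul : uniq l3.
  by apply: allpairs_uniq_dep => [||[a b] [c d] _ _ [-> ->]//];
     do ?by move=> *; exact: splits_uniq.
have ur : uniq r3.
  by apply: allpairs_uniq_dep => [||[a b] [c d] _ _ [-> ->]//];
     do ?by move=> *; exact: splits_uniq.
have lr : perm_eq l3 (map t r3).
  apply: uniq_perm => //.
    rewrite map_inj_in_uniq // => w w'.
    move=> /allpairsPdep[[a b] [[c d] [_]]]; rewrite mem_splits /=.
    move=> /eqP <- -> /allpairsPdep[[a' b'] [[c' d'] [_]]].
    by rewrite mem_splits /= => /eqP <- -> [-> _ -> ->].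
  move=> [[a b] [c d]]; apply/allpairsPdep/mapP => /=.
    move=> [[x y] [[z w] []]]; rewrite !mem_splits /= => /eqP mE /eqP yE.
    move=> [-> -> -> ->]; exists ((x + z, w), (x, z)); last by rewrite /t /= yE.
    apply/allpairsPdep; exists (x + z, w), (x, z).
    by rewrite !mem_splits /= -addrA yE mE !eqxx.
  move=> [w /allpairsPdep[[x y] [[z v] []]]].
  rewrite !mem_splits /= => /eqP mE /eqP xE -> [-> -> -> ->].
  by exists (z, v + y), (v, y); rewrite !mem_splits /= addrA xE mE !eqxx.
rewrite (perm_big _ lr) big_map; apply: eq_bigr => w _.
by rewrite /F /K /= mulrA.
Qed.

Fact series_mul1 : left_id (series_const 1) series_mul.
Proof.
move=> f; apply/funext => m; rewrite /series_mul.
have m0 : (0, m) \in splits m by rewrite mem_splits /= add0r.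
rewrite (bigD1_seq _ m0 (splits_uniq m)) /= /series_const eqxx mul1r.
rewrite big_seq_cond big1 ?addr0// => -[a b] /andP[]; rewrite mem_splits /=.
move=> /eqP <-; case: (eqVneq a 0) => [->|_ _]; last by rewrite mul0r.
by rewrite add0r eqxx.
Qed.

Fact series_mulDl : left_distributive series_mul +%R.
Proof.
move=> f g h; apply/funext => m.
transitivity (series_mul f h m + series_mul g h m) => //.
by rewrite /series_mul -big_split; apply: eq_bigr => u _; exact: mulrDl.
Qed.

Fact series_1neq0 : series_const 1 != 0 :> series M A.
Proof.
apply/eqP => /(congr1 (fun f : series M A => f 0)).
by rewrite /series_const eqxx => /eqP; rewrite oner_eq0.
Qed.

HB.instance Definition _ := GRing.Zmodule_isComNzRing.Build (series M A)
  series_mulA series_mulC series_mul1 series_mulDl series_1neq0.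
End SeriesRing.

Section PowerSeries.
Variable I : finType.

Definition ffun_splits (m : {ffun I -> nat}) :
    seq ({ffun I -> nat} * {ffun I -> nat}) :=
  [seq ([ffun i => val (h i)], [ffun i => m i - h i]%N)
     | h : {ffun I -> 'I_(\sum_i m i).+1} in
       [pred h : {ffun I -> 'I_(\sum_i m i).+1} |
          [forall i, (h i <= m i)%N]]].

Fact ffun_splits_uniq m : uniq (ffun_splits m).
Proof.
rewrite map_inj_uniq ?enum_uniq// => h h' [/ffunP e _].
by apply/ffunP => i; apply/val_inj; have := e i; rewrite !ffunE.
Qed.

Fact mem_ffun_splits m u : (u \in ffun_splits m) = (u.1 + u.2 == m).
Proof.
apply/mapP/eqP => [[h]|].
  rewrite mem_enum => /forallP le_hm -> /=.
  by apply/ffunP => i; rewrite !ffunE; apply: subnKC.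
case: u => [/= a b] <-.
have lt_a (i : I) :
    ((a : {ffun I -> nat}) i < (\sum_j (a + b : {ffun I -> nat})%R j).+1)%N.
  by rewrite ltnS (bigD1 i) //= ffunE -addnA leq_addr.
exists [ffun i => Ordinal (lt_a i)].
  by rewrite mem_enum; apply/forallP => i; rewrite !ffunE leq_addr.
by congr pair; apply/ffunP => i; rewrite !ffunE ?addKn.
Qed.

HB.instance Definition _ := Nmodule_hasSplits.Build {ffun I -> nat}
  ffun_splits_uniq mem_ffun_splits.

Variable A : comNzRingType.

(* Formal power series over A in commuting variables t^i, i : I.              *)
Definition powser : Type := series {ffun I -> nat} A.
HB.instance Definition _ := GRing.ComNzRing.on powser.

Definition mnm1 (i : I) : {ffun I -> nat} := [ffun j => (j == i) : nat].
Definition pvar (i : I) : powser := fun m => if m == mnm1 i then 1 else 0.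
Definition pderiv (i : I) (f : powser) : powser :=
  fun m => f (m + mnm1 i) *+ (m i).+1.
End PowerSeries.

(* The cohomological data of a smooth projective variety of dimension dimX with
   vanishing odd cohomology: the ring H^*(X, C) under cup product, its Hodge
   decomposition, integration over X, and the Chern classes of the tangent
   bundle.                                                                    *)
Record cohomology (C : fieldType) := Cohomology {
  dimX : nat;
  coh :> falgType C;
  cupC : forall x y : coh, x * y = y * x;
  hodge : nat -> nat -> {vspace coh};
  hodge_bound : forall p q, (dimX < p)%N || (dimX < q)%N -> hodge p q = 0%VS;
  hodge_odd : forall p q, odd (p + q) -> hodge p q = 0%VS;
  hodge_direct :
    directv (\sum_(u : 'I_dimX.+1 * 'I_dimX.+1) hodge u.1 u.2)%VS;
  hodge_full :
    (\sum_(u : 'I_dimX.+1 * 'I_dimX.+1) hodge u.1 u.2)%VS = {:coh}%VS;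
  hodge_unit : hodge 0 0 = <[1]>%VS;
  hodge_cup : forall p q p' q' x y, x \in hodge p q -> y \in hodge p' q' ->
    x * y \in hodge (p + p') (q + q');
  integral : 'Hom(coh, C^o);
  integral_top : forall p q x, x \in hodge p q -> (p, q) != (dimX, dimX) ->
    integral x = 0;
  poincare : forall x, (forall y, integral (x * y) = 0) -> x = 0;
  chern : nat -> coh;
  chern0 : chern 0 = 1;
  chern_hodge : forall i, chern i \in hodge i i
}.

(* Tree-level Gromov-Witten theory in the axiomatic form of Kontsevich and
   Manin, restricted to primary invariants.  GW L [:: x1; ..; xk] is the
   integral of ev_1^* x1 .. ev_k^* xk over the virtual class of the moduli
   space of genus-0 stable maps of class L with k marked points.  effcone is
   the monoid of classes of effective curves; only finitely many of them have
   bounded degree for an ample class, which gives its splitNmodType structure.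
   vdim is the complex virtual dimension of the moduli space.  The virtual
   class is algebraic, so both Hodge degrees of the insertions must add up to
   vdim.  The value on the class 0 covers both the mapping-to-a-point axiom and
   the convention that unstable terms are zero.                               *)
Record gromov_witten (C : fieldType) (X : cohomology C) := GromovWitten {
  H2 : zmodType;
  effcone : splitNmodType;
  curve_class : {additive effcone -> H2};
  curve_class_inj : injective curve_class;
  pairing : H2 -> 'Hom(X, C^o);
  pairingD : {morph pairing : L L' / L + L'};
  GW : H2 -> seq X -> C;
  GW_linear : forall L a x y s,
    GW L (a *: x + y :: s) = a * GW L (x :: s) + GW L (y :: s);
  GW_perm : forall L s s', perm_eq s s' -> GW L s = GW L s';
  GW_effective : forall L s, GW L s != 0 -> exists l, L = curve_class l;
  GW_dimension : forall L s (pq : seq (nat * nat)),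
    all2 (fun x u => x \in hodge X u.1 u.2) s pq -> GW L s != 0 ->
    let vdim := (dimX X)%:R - 3 + pairing L (chern X 1) + (size s)%:R in
    \sum_(u <- pq) u.1%:R = vdim /\ \sum_(u <- pq) u.2%:R = vdim;
  GW_point : forall s,
    GW 0 s = if s is [:: x; y; z] then integral X (x * y * z) else 0;
  GW_unit : forall L s, L != 0 -> GW L (1 :: s) = 0;
  GW_divisor : forall L x s p q, L != 0 -> x \in hodge X p q ->
    (p + q = 2)%N -> GW L (x :: s) = pairing L x * GW L s;
  GW_wdvv : forall (l : effcone) (s : seq X) (n : nat) (e e' : 'I_n -> X),
    n = \dim {:X} ->
    (forall i j, integral X (e i * e' j) = (i == j)%:R) ->
    let S (x y z w : X) :=
      \sum_(u <- splits l) \sum_(B : (size s).-tuple bool) \sum_(i < n)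
        GW (curve_class u.1) ([:: x; y; e i] ++ mask B s) *
        GW (curve_class u.2) ([:: e' i; z; w] ++ mask (map negb B) s) in
    forall x y z w, S x y z w = S x z y w
}.

(* Indices are shifted by one: ord0 labels the identity class gamma_1.         *)
Record hodge_basis (C : fieldType) (X : cohomology C) := HodgeBasis {
  rk : nat;
  cls : rk.+1.-tuple X;
  cls_basis : basis_of {:X} cls;
  cls1 : tnth cls ord0 = 1;
  pdeg : 'I_rk.+1 -> nat;
  qdeg : 'I_rk.+1 -> nat;
  cls_hodge : forall a, tnth cls a \in hodge X (pdeg a) (qdeg a)
}.

Section SmallPhaseSpace.
Variables (C : fieldType) (X : cohomology C).
Variables (W : gromov_witten X) (B : hodge_basis X).

Local Notation idx := 'I_(rk B).+1.

(* Formal sums over effective classes l of f l * q^l.                         *)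
Definition novikov : Type := series (effcone W) C.
HB.instance Definition _ := GRing.ComNzRing.on novikov.

(* Formal functions of t^1, .., t^N.                                          *)
Definition sfun : Type := powser idx novikov.
HB.instance Definition _ := GRing.ComNzRing.on sfun.

Definition scal (c : C) : sfun :=
  @series_const {ffun idx -> nat} novikov (@series_const (effcone W) C c).

(* Row vector of coefficients of a vector field on the coordinate fields.     *)
Definition vfield : Type := 'rV[sfun]_((rk B).+1).
HB.instance Definition _ := GRing.Lmodule.on vfield.

Definition eta : 'M[C]_((rk B).+1) :=
  \matrix_(a, b) integral X (tnth (cls B) a * tnth (cls B) b).

Definition bdeg (a : idx) : C := (pdeg a)%:R - ((dimX X)%:R - 1) / 2.

Definition glow (a : idx) : vfield := delta_mx 0 a.
Definition gup (a : idx) : vfield := \row_b scal (invmx eta b a).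

Definition correlator (s : seq X) : novikov := fun l => GW (curve_class W l) s.

(* The coefficient of t^m collects the tuples of indices with content m in
   sum_k 1/k! sum_(a1 .. ak) t^a1 .. t^ak <gamma_a1 .. gamma_ak>_0.           *)
Definition F0 : sfun := fun m =>
  let k := (\sum_a m a)%N in
  @series_const (effcone W) C (k`!%:R)^-1 *
  \sum_(a : k.-tuple idx | [ffun i => count_mem i a] == m)
     correlator [seq tnth (cls B) i | i <- a].

Definition bracket (vs : seq vfield) : sfun :=
  \sum_(a : (size vs).-tuple idx)
    (\prod_(i < size vs) (nth (0 : vfield) vs i) 0 (tnth a i)) *
    foldr (@pderiv idx novikov) F0 a.

Definition dirder (v : vfield) (f : sfun) : sfun :=
  \sum_a v 0 a * @pderiv idx novikov a f.

Definition qprod (v w : vfield) : vfield :=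
  \sum_a bracket [:: v; w; gup a] *: glow a.

Definition Gop (v : vfield) : vfield := \row_a (scal (bdeg a) * v 0 a).

Definition Delta : vfield := \sum_a qprod (gup a) (glow a).

Definition euler : vfield :=
  \row_a (scal (coord (cls B) a (chern X 1)) +
          scal (bdeg ord0 + 1 - bdeg a) * @pvar idx novikov a).

Definition Epow (k : nat) : vfield := iter k (qprod euler) (glow ord0).

Definition Phi (k : nat) : sfun :=
  match k with
  | 0 => 0
  | 1 => scal (- 24^-1 * integral X (chern X 1 * chern X (dimX X - 1)))
  | _ =>
    - scal 24^-1 * (\sum_(0 <= m < k) \sum_a \sum_b \sum_c
        scal (bdeg a) * bracket [:: glow ord0; Epow m; gup a]
                      * bracket [:: glow a; Epow (k - 1 - m); gup b]
                      * bracket [:: glow b; glow c; gup c])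
    - scal 4^-1 * (\sum_(0 <= m < k) \sum_a \sum_b
        scal (bdeg a) * scal (bdeg b)
                      * bracket [:: glow a; Epow m; gup b]
                      * bracket [:: glow b; Epow (k - 1 - m); gup a])
    + scal (k%:R / 12) * (\sum_c bracket [:: glow c; Epow (k - 1); gup c])
  end.
End SmallPhaseSpace.

Arguments Phi {C X} W B k.
Arguments euler {C X} W B.
Arguments glow {C X W B} a.
Arguments gup {C X W B} a.
Arguments bracket {C X W B} vs.
Arguments dirder {C X W B} v f.
Arguments qprod {C X W B} v w.
Arguments Gop {C X W B} v.
Arguments Delta {C X W B}.
Arguments Epow {C X W B} k.

Notation "<<( x ; .. ; y )>>" := (bracket (cons x .. (cons y nil) ..))
  (at level 0, x at level 99, y at level 99) : ring_scope.
Notation "v \oq w" := (qprod v w) (at level 40, left associativity) : ring_scope.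

(* Main.v *)
(* Let M_v be quantum multiplication by v, U = M_E, G the grading operator,
   T(v, w) = sum_mu <<v w gamma_mu gamma^mu>>_0 and theta(v) = tr M_v = <v, Delta>.
   Up to constants, Phi_k combines the traces of M_{G(E^m)} U^(k-1-m), of
   G U^m G U^(k-1-m) and of U^(k-1).  The divisor and dimension axioms give
   d_a U = M_a + [M_a, G], so differentiating the second and third traces only
   needs that multiplications commute: by cyclicity the terms cubic in G
   cancel.  In the first trace the derivative of M_{G(E^m)} is a four-point
   function.  The derivative of associativity trades it for T(G(E^m), E^j o a)
   plus four-point functions with a power of E as an insertion, and d_a U^j
   reduces those to three-point functions.  What remains are
   sums over triples of exponents, matched with the adjunction G + G^* = 1. *)
Require Import Defs.
From HB Require Import structures.
From mathcomp Require Import all_boot all_order all_algebra all_field.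
From mathcomp Require Import boolp reals complex.
From mathcomp Require Import ring zify.
Set Implicit Arguments.
Unset Strict Implicit.
Unset Printing Implicit Defensive.
Import GRing.Theory.
Local Open Scope ring_scope.

(** * Sums over triples of exponents of given total *)

(** The obstacle is that G(E^m) is not a power of E, so no axiom evaluates a four-point function
    with this insertion. The answer keeps such functions, but only contracted with a pair gamma_mu,
    gamma^mu and no further operator; powers of U standing outside have to be moved into an
    insertion. Associativity does this at the price of four-point functions with E^p inserted, and
    these are known because multiplication by E^p is U^p. The commutator in d_a U expresses
    homogeneity of the third derivatives of F_0 along E; the summand M_a appears when an index is
    raised, because G + G^* = 1. After scaling by 24 the three traces carry the weights -1, -6 and
    2k. The 12 is the 6 doubled by the symmetry of the two gradings. Rewriting the resulting traces
    through gamma_mu and gamma^mu costs 3k(k-1) copies of theta(E^(k-2) o gamma_a), and 2k(k-1) -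
    3k(k-1) = -k(k-1). The operator calculus lives over a commutative ring with derivations in which
    2 need not be invertible; hence identities multiplied by 2 or 4. *)

Section TriangularSums.
Variable V : zmodType.
Implicit Types (n : nat) (f : nat -> V) (F : nat -> nat -> nat -> V).

(* The sum of F a b c over all a + b + c = n - 1. *)
Definition trisum n F : V :=
  \sum_(0 <= a < n) \sum_(0 <= b < n - a) F a b (n - a - 1 - b)%N.

Lemma sum_nat_rev n f : \sum_(0 <= a < n) f a = \sum_(0 <= a < n) f (n - 1 - a)%N.
Proof.
rewrite big_nat_rev /= add0n; apply: eq_big_nat => a _.
by congr f; lia.
Qed.

Lemma eq_trisum n F F' :
  (forall a b c, (a + b + c + 1 = n)%N -> F a b c = F' a b c) ->
  trisum n F = trisum n F'.
Proof.
move=> eqF; apply: eq_big_nat => a lt_a; apply: eq_big_nat => b lt_b.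
by apply: eqF; lia.
Qed.

Lemma trisumD n F F' :
  trisum n (fun a b c => F a b c + F' a b c) = trisum n F + trisum n F'.
Proof. by rewrite -big_split; apply: eq_bigr => a _; rewrite -big_split. Qed.

Lemma trisumN n F : trisum n (fun a b c => - F a b c) = - trisum n F.
Proof. by rewrite -sumrN; apply: eq_bigr => a _; rewrite -sumrN. Qed.

Lemma trisumCr n F : trisum n F = trisum n (fun a b c => F a c b).
Proof.
apply: eq_big_nat => a lt_a; rewrite sum_nat_rev; apply: eq_big_nat => b lt_b.
by congr F; lia.
Qed.

(** In terms of the first two exponents the index set is a + b < n, which is symmetric; they
    determine the third exponent. *)
Lemma trisumCl n F : trisum n F = trisum n (fun a b c => F b a c).
Proof.
have trisumE F' : trisum n F' =
    \sum_(0 <= a < n) \sum_(0 <= b < n | (a + b < n)%N) F' a b (n - 1 - a - b)%N.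
  apply: eq_big_nat => a lt_a.
  rewrite (big_nat_widen _ _ n) ?leq_subr//=.
  by apply: congr_big_nat => // b lt_b; [lia | congr F'; lia].
rewrite !trisumE (exchange_big_dep_nat predT) //=.
apply: eq_big_nat => b lt_b; apply: congr_big_nat => // a lt_a.
  by rewrite addnC.
by congr F; lia.
Qed.

Lemma trisum_fst n f :
  trisum n (fun a _ _ => f a) = \sum_(0 <= a < n) f a *+ (n - a).
Proof.
by apply: eq_big_nat => a lt_a; rewrite sumr_const_nat subn0.
Qed.

Lemma trisum_outer_fst n F :
  \sum_(0 <= m < n.+1) \sum_(0 <= j < n - m) F m j (n - m - 1 - j)%N =
  trisum n F.
Proof. by rewrite big_nat_recr //= subnn [X in _ + X]big_geq // addr0. Qed.

(** The outer index is n minus the last exponent; m = 0 contributes an empty sum. *)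
Lemma trisum_outer_last n F :
  \sum_(0 <= m < n.+1) \sum_(0 <= j < m) F j (m - 1 - j)%N (n - m)%N =
  trisum n F.
Proof.
rewrite trisumCr trisumCl -trisum_outer_fst sum_nat_rev.
apply: eq_big_nat => m lt_m.
have -> : (n.+1 - 1 - m = n - m)%N by lia.
by apply: eq_big_nat => j lt_j; congr F; lia.
Qed.

(** This is the shape of the double sums in the theorem: the exponents k-i-1, i-j and j-1 add up to
    k-2. *)
Lemma trisum_shifted k F :
  \sum_(1 <= i < k) \sum_(1 <= j < i.+1) F (k - i - 1)%N (i - j)%N j.-1 =
  trisum k.-1 F.
Proof.
case: k => [|n]; first by rewrite /trisum !big_geq.
rewrite big_add1 /= sum_nat_rev.
apply: eq_big_nat => i lt_i; rewrite big_add1 /= sum_nat_rev.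
have -> : ((n - 1 - i).+1 = n - i)%N by lia.
by apply: eq_big_nat => j lt_j; congr F; lia.
Qed.
End TriangularSums.

(** * Calculus of multiplication operators *)

(* Vector fields are row vectors and operators act on them from the right, so
   products of matrices are in the reverse order of compositions.  P a is
   multiplication by gamma_a, d a the derivative along t^a, H the Gram matrix,
   G the grading and D the vector field Delta. *)
Section FrobeniusCalculus.
Variables (S : comNzRingType) (r : nat).
Local Notation N := r.+1.
Implicit Types (a b c : 'I_N) (u v w x : 'rV[S]_N) (A B : 'M[S]_N) (m n p : nat).

Variable d : 'I_N -> S -> S.
Hypothesis dD : forall a, {morph d a : s t / s + t}.
Hypothesis dM : forall a s t, d a (s * t) = d a s * t + s * d a t.

Variable P : 'I_N -> 'M[S]_N.
(* Locked, so that rewriting with distributivity does not see the sum. *)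
Definition opmul : 'rV[S]_N -> 'M[S]_N := locked (fun v => \sum_a v 0 a *: P a).
Hypothesis row_opbase : forall a b, row a (P b) = row b (P a).
Hypothesis opmul_row : forall a b, opmul (row a (P b)) = P b *m P a.
Hypothesis d_opbase : forall a b, map_mx (d a) (P b) = map_mx (d b) (P a).

Variable one : 'rV[S]_N.
Hypothesis one_opbase : forall a, one *m P a = delta_mx 0 a.
Hypothesis d_one : forall a, map_mx (d a) one = 0.

Variables H G : 'M[S]_N.
Hypothesis trH : H^T = H.
Hypothesis opbase_adj : forall a, P a *m H = H *m (P a)^T.
Hypothesis grading_adj : G *m H + H *m G^T = H.
Hypothesis d_grading : forall a, map_mx (d a) G = 0.

Variable E : 'rV[S]_N.
Local Notation U := (opmul E).
Hypothesis d_euler :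
  forall a, map_mx (d a) U = P a + (G *m P a - P a *m G).

Variable D : 'rV[S]_N.
Definition bform u v : S := (u *m H *m v^T) 0 0.
Hypothesis trace_opmul : forall v, \tr (opmul v) = bform v D.

Definition epow m : 'rV[S]_N := one *m U ^+ m.

(** * Multiplication operators and the invariant form *)

Lemma opmulE v : opmul v = \sum_a v 0 a *: P a.
Proof. by rewrite /opmul -lock. Qed.

Fact opmul_is_linear : linear opmul.
Proof.
move=> s u v; rewrite !opmulE scaler_sumr -big_split; apply: eq_bigr => a _.
by rewrite !mxE scalerDl scalerA.
Qed.
HB.instance Definition _ :=
  GRing.isLinear.Build S 'rV[S]_N 'M[S]_N *:%R opmul opmul_is_linear.

Lemma bformC u v : bform u v = bform v u.
Proof.
rewrite /bform -[in LHS](trmxK (u *m H *m v^T)) [in LHS]mxE.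
by rewrite !trmx_mul trmxK trH mulmxA.
Qed.

Lemma bformDl u v w : bform (u + v) w = bform u w + bform v w.
Proof. by rewrite /bform !mulmxDl mxE. Qed.

Lemma bformNl u w : bform (- u) w = - bform u w.
Proof. by rewrite /bform !mulNmx mxE. Qed.

Lemma bformBl u v w : bform (u - v) w = bform u w - bform v w.
Proof. by rewrite bformDl bformNl. Qed.

Lemma bform_suml (I : Type) (s : seq I) (f : I -> 'rV[S]_N) w :
  bform (\sum_(i <- s) f i) w = \sum_(i <- s) bform (f i) w.
Proof. by rewrite /bform !mulmx_suml summxE. Qed.

Lemma bformMnl u w n : bform (u *+ n) w = bform u w *+ n.
Proof. by rewrite -(card_ord n) -!sumr_const bform_suml. Qed.

Lemma opmul_delta a : opmul (delta_mx 0 a) = P a.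
Proof.
rewrite opmulE (bigD1 a) //= mxE !eqxx scale1r big1 ?addr0// => b nba.
by rewrite mxE eqxx (negbTE nba) scale0r.
Qed.

Lemma opmulC u v : u *m opmul v = v *m opmul u.
Proof.
rewrite [in LHS](row_sum_delta u) [in RHS](row_sum_delta v).
rewrite mulmx_suml [RHS]mulmx_suml !opmulE.
under eq_bigr do rewrite mulmx_sumr.
under [RHS]eq_bigr do rewrite mulmx_sumr.
rewrite exchange_big; apply: eq_bigr => a _; apply: eq_bigr => b _.
rewrite -!scalemxAl -!scalemxAr !scalerA mulrC.
by congr (_ *: _); rewrite -!rowE row_opbase.
Qed.

(** Associativity in the form [opmul_row], extended bilinearly. *)
Lemma opmulM u v : opmul (u *m opmul v) = opmul v *m opmul u.
Proof.
rewrite [in LHS](row_sum_delta u) mulmx_suml linear_sum /=.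
rewrite [X in _ = _ *m X]opmulE mulmx_sumr; apply: eq_bigr => a _.
rewrite -scalemxAl linearZ /= -scalemxAr; congr (_ *: _).
rewrite -rowE [X in row a X]opmulE [X in _ = X *m _]opmulE mulmx_suml.
rewrite raddf_sum linear_sum; apply: eq_bigr => b _ /=.
by rewrite linearZ /= linearZ /= opmul_row scalemxAl.
Qed.

Lemma opmul_comm u v : opmul u *m opmul v = opmul v *m opmul u.
Proof. by rewrite -!opmulM opmulC. Qed.

Lemma opmul_one : opmul one = 1%:M.
Proof.
apply/row_matrixP => a; rewrite rowE opmulC opmul_delta one_opbase.
by rewrite rowE mulmx1.
Qed.

Lemma opmul_epow m : opmul (epow m) = U ^+ m.
Proof.
elim: m => [|m IH]; first by rewrite /epow expr0 mulmx1 opmul_one.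
by rewrite /epow exprSr -mulmxE mulmxA opmulM IH mulmxE -exprS exprSr.
Qed.

Lemma epowS m : epow m.+1 = E *m opmul (epow m).
Proof. by rewrite -opmulC /epow exprSr -mulmxE mulmxA. Qed.

Lemma pow_opmul_comm m v : U ^+ m *m opmul v = opmul v *m U ^+ m.
Proof. by rewrite -opmul_epow opmul_comm. Qed.

Lemma powD m n : U ^+ m *m U ^+ n = U ^+ (m + n).
Proof. by rewrite exprD. Qed.

Lemma opmul_adj w : opmul w *m H = H *m (opmul w)^T.
Proof.
rewrite !opmulE mulmx_suml linear_sum mulmx_sumr; apply: eq_bigr => a _ /=.
by rewrite linearZ /= -scalemxAl -scalemxAr opbase_adj.
Qed.

Lemma bform_opmul u v w : bform (u *m opmul w) v = bform u (v *m opmul w).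
Proof.
rewrite /bform trmx_mul -!mulmxA [in LHS](mulmxA (opmul w)).
by rewrite opmul_adj !mulmxA.
Qed.

Lemma bform_pow u v m : bform (u *m U ^+ m) v = bform u (v *m U ^+ m).
Proof. by rewrite -opmul_epow bform_opmul. Qed.

(** The adjoint of G is 1 - G; this is how a grading is moved across the form. *)
Lemma bform_grading u v : bform (u *m G) v = bform u v - bform u (v *m G).
Proof.
apply/eqP; rewrite eq_sym subr_eq; apply/eqP.
rewrite /bform trmx_mul -{1}grading_adj mulmxDr mulmxDl mxE.
by rewrite -!mulmxA.
Qed.

(** * Derivations of matrices and four-point operators *)

Lemma map_d_additive a m n (A B : 'M[S]_(m, n)) :
  map_mx (d a) (A + B) = map_mx (d a) A + map_mx (d a) B.
Proof. by apply/matrixP => i j; rewrite !mxE dD. Qed.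

Lemma derivation0 a : d a 0 = 0.
Proof. by apply: (addrI (d a 0)); rewrite -dD !addr0. Qed.

Lemma map_d_sum a m n (I : Type) (s : seq I) (f : I -> 'M[S]_(m, n)) :
  map_mx (d a) (\sum_(i <- s) f i) = \sum_(i <- s) map_mx (d a) (f i).
Proof.
apply: (big_morph _ (@map_d_additive a m n)).
by apply/matrixP => i j; rewrite !mxE derivation0.
Qed.

Lemma derivation_sum a (I : Type) (s : seq I) (f : I -> S) :
  d a (\sum_(i <- s) f i) = \sum_(i <- s) d a (f i).
Proof. exact: (big_morph _ (dD a) (derivation0 a)). Qed.

Lemma map_d_mul a m n p (A : 'M[S]_(m, n)) (B : 'M[S]_(n, p)) :
  map_mx (d a) (A *m B) = map_mx (d a) A *m B + A *m map_mx (d a) B.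
Proof.
apply/matrixP => i j; rewrite !mxE derivation_sum -big_split.
by apply: eq_bigr => k _; rewrite !mxE dM.
Qed.

Lemma derivation_trace a A : d a (\tr A) = \tr (map_mx (d a) A).
Proof. by rewrite /mxtrace derivation_sum; apply: eq_bigr => i _; rewrite mxE. Qed.

(* The operator z |-> sum_c <<u v z gamma^c>> gamma_c. *)
Definition dopmul u v : 'M[S]_N :=
  \sum_a \sum_b (u 0 a * v 0 b) *: map_mx (d a) (P b).

Lemma dopmulC u v : dopmul u v = dopmul v u.
Proof.
rewrite /dopmul exchange_big; apply: eq_bigr => a _; apply: eq_bigr => b _.
by rewrite mulrC d_opbase.
Qed.

Lemma dopmulE u v :
  dopmul u v = \sum_a u 0 a *: \sum_b v 0 b *: map_mx (d a) (P b).
Proof.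
apply: eq_bigr => a _; rewrite scaler_sumr.
by apply: eq_bigr => b _; rewrite scalerA.
Qed.

Lemma dopmul_delta a v :
  dopmul (delta_mx 0 a) v = \sum_b v 0 b *: map_mx (d a) (P b).
Proof.
rewrite dopmulE (bigD1 a) //= mxE !eqxx scale1r [X in _ + X]big1 ?addr0// => b nba.
by rewrite mxE eqxx (negbTE nba) scale0r.
Qed.

Lemma dopmul_sum u v : dopmul u v = \sum_a u 0 a *: dopmul (delta_mx 0 a) v.
Proof. by rewrite dopmulE; under eq_bigr do rewrite -dopmul_delta. Qed.

(** Leibniz rule: the coefficients of v and the structure constants are differentiated separately,
    and the latter give the four-point operator. *)
Lemma map_d_opmul a v :
  map_mx (d a) (opmul v) =
  opmul (map_mx (d a) v) + dopmul (delta_mx 0 a) v.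
Proof.
rewrite dopmul_delta !opmulE map_d_sum -big_split; apply: eq_bigr => b _.
by apply/matrixP => i j; rewrite !mxE dM.
Qed.

(** Derivative of the commutativity [row_opbase]. Together with [dopmulC] it makes the four-point
    function symmetric in its three insertions. *)
Lemma dopmulC3 u v w : w *m dopmul u v = v *m dopmul u w.
Proof.
rewrite !(dopmul_sum u) !mulmx_sumr; apply: eq_bigr => a _.
rewrite -!scalemxAr; congr (_ *: _); apply/matrixP => i j.
rewrite !dopmul_delta !mulmx_sumr !summxE (ord1 i).
under eq_bigr do rewrite -scalemxAr !mxE mulr_sumr.
under [RHS]eq_bigr do rewrite -scalemxAr !mxE mulr_sumr.
rewrite exchange_big; apply: eq_bigr => b _; apply: eq_bigr => c _.
rewrite !mxE mulrCA; congr (_ * (_ * _)).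
by have /rowP/(_ j) := row_opbase b c; rewrite !mxE => ->.
Qed.

(** Derivative of [opmulM]. The terms that differentiate the coefficients of v and w occur on both
    sides and cancel, so what is left is tensorial and extends linearly from coordinate fields to
    all u. *)
Lemma dopmul_associativity u v w :
  dopmul u (v *m opmul w) + opmul (v *m dopmul u w) =
  dopmul u w *m opmul v + opmul w *m dopmul u v.
Proof.
rewrite !(dopmul_sum u) mulmx_suml !mulmx_sumr linear_sum -!big_split.
apply: eq_bigr => a _ /=.
rewrite -!scalemxAr -scalemxAl linearZ /= -!scalerDr; congr (_ *: _).
have := map_d_opmul a (v *m opmul w).
rewrite opmulM !map_d_mul !map_d_opmul mulmxDr mulmxDl !mulmxDr !linearD /=.
rewrite !opmulM [opmul (map_mx _ w) *m _]opmul_comm.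
set A1 := _ *m opmul (map_mx _ w); set A2 := _ *m opmul (map_mx _ v).
set B1 := _ *m opmul v; set B2 := opmul w *m dopmul _ _.
set B3 := opmul (_ *m _); set B4 := dopmul _ (_ *m _).
rewrite addrACA => e; apply: (addrI (A1 + A2)); rewrite e.
by rewrite [A1 + A2]addrC [B4 + B3]addrC !addrA.
Qed.

Definition grading_commutator w : 'M[S]_N := G *m opmul w - opmul w *m G.
(** The part of the derivative of U^p along w that comes from the grading. Being linear in w, it
    makes sense for fields with non-constant coefficients. *)
Definition pow_commutator w p : 'M[S]_N :=
  \sum_(0 <= j < p) U ^+ j *m grading_commutator w *m U ^+ (p - 1 - j).

Lemma derivation1 a : d a 1 = 0.
Proof. by apply: (addrI (d a 1)); rewrite addr0 -{3}(mul1r 1) dM mulr1 mul1r. Qed.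

Lemma map_d_1 a : map_mx (d a) (1%:M : 'M[S]_N) = 0.
Proof.
apply/matrixP => i j; rewrite !mxE.
by case: (i == j); rewrite ?mulr1n ?mulr0n ?derivation0 ?derivation1.
Qed.

Lemma map_d_pow_sum a (A : 'M[S]_N) p : map_mx (d a) (A ^+ p) =
  \sum_(0 <= j < p) A ^+ j *m map_mx (d a) A *m A ^+ (p - 1 - j).
Proof.
elim: p => [|p IH]; first by rewrite expr0 big_geq // map_d_1.
rewrite exprSr -mulmxE map_d_mul IH mulmx_suml big_nat_recr //=; congr (_ + _).
  apply: eq_big_nat => j lt_j; rewrite -mulmxA; congr (_ *m _).
  by rewrite mulmxE -exprSr; congr (_ ^+ _); lia.
by rewrite subn1 subnn expr0 mulmx1.
Qed.

Lemma map_d_pow a p : map_mx (d a) (U ^+ p) =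
  (P a *m U ^+ (p - 1)) *+ p + pow_commutator (delta_mx 0 a) p.
Proof.
rewrite map_d_pow_sum d_euler /pow_commutator.
(* One copy of [P a *m U ^+ (p - 1)] for each position j of the differentiated factor, so that both
   sides match term by term. *)
have -> A n : A *+ n = \sum_(0 <= j < n) A by rewrite sumr_const_nat subn0.
rewrite -big_split; apply: eq_big_nat => j lt_j /=.
rewrite /grading_commutator opmul_delta [U ^+ j *m (P a + _)]mulmxDr mulmxDl.
congr (_ + _).
rewrite -opmul_delta pow_opmul_comm -mulmxA powD; congr (_ *m U ^+ _); lia.
Qed.

Lemma grading_commutator_sum w :
  grading_commutator w = \sum_a w 0 a *: grading_commutator (delta_mx 0 a).
Proof.
rewrite /grading_commutator opmulE mulmx_suml mulmx_sumr -sumrB; apply: eq_bigr => a _.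
by rewrite -scalemxAl -scalemxAr -scalerBr opmul_delta.
Qed.

Lemma pow_commutator_sum w p :
  pow_commutator w p = \sum_a w 0 a *: pow_commutator (delta_mx 0 a) p.
Proof.
rewrite /pow_commutator; under [RHS]eq_bigr do rewrite scaler_sumr.
rewrite exchange_big; apply: eq_bigr => j _ /=.
rewrite grading_commutator_sum mulmx_sumr mulmx_suml; apply: eq_bigr => a _.
by rewrite -scalemxAr -scalemxAl.
Qed.

Lemma map_d_epow a m : map_mx (d a) (epow m) =
  (delta_mx 0 a *m U ^+ (m - 1)) *+ m +
  one *m pow_commutator (delta_mx 0 a) m.
Proof.
rewrite /epow map_d_mul d_one mul0mx add0r map_d_pow mulmxDr; congr (_ + _).
by rewrite (raddfMn (mulmx one)) /= mulmxA one_opbase.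
Qed.

(** Multiplication by E^p is U^p, so its derivative is given both by [map_d_opmul] and by
    [map_d_pow]. The terms with the factor p cancel, and a four-point function with E^p inserted
    reduces to three-point functions. *)
Lemma dopmul_epow w p : dopmul w (epow p) =
  pow_commutator w p - opmul (one *m pow_commutator w p).
Proof.
rewrite dopmul_sum pow_commutator_sum mulmx_sumr linear_sum -sumrB.
apply: eq_bigr => a _ /=; rewrite -scalemxAr linearZ -scalerBr; congr (_ *: _).
apply/eqP; rewrite eq_sym subr_eq addrC; apply/eqP.
have := map_d_opmul a (epow p).
rewrite opmul_epow map_d_pow map_d_epow linearD linearMn /= -opmul_epow opmulM.
by rewrite opmul_epow -opmul_delta pow_opmul_comm -addrA => /addrI.
Qed.

(** * Traces and their derivatives *)

(** By cyclicity the commutator is paired with a product of multiplications, and this product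
    commutes with M_w. *)
Lemma trace_grading_commutator u v w :
  \tr (opmul u *m grading_commutator w *m opmul v) = 0.
Proof.
rewrite mxtrace_mulC mulmxA -opmulM /grading_commutator mulmxBr linearB /=.
by rewrite mulmxA mxtrace_mulC mulmxA opmul_comm -mulmxA subrr.
Qed.

Lemma trace_pow_commutator v w p : \tr (pow_commutator w p *m opmul v) = 0.
Proof.
rewrite /pow_commutator mulmx_suml linear_sum big1 // => j _ /=.
rewrite -[_ *m U ^+ _ *m _]mulmxA -opmul_epow pow_opmul_comm -!opmul_epow.
by rewrite -opmulM trace_grading_commutator.
Qed.

Lemma opmul_pow u p : opmul u *m U ^+ p = opmul (u *m U ^+ p).
Proof. by rewrite -pow_opmul_comm -!opmul_epow opmulM. Qed.

Lemma trace_opmul_pow u p : \tr (opmul u *m U ^+ p) = bform (u *m U ^+ p) D.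
Proof. by rewrite opmul_pow trace_opmul. Qed.

(** The trace of [dopmul_associativity] for v, x and E^p moves U^p into an insertion. Besides the
    two traces of the statement it contains only four-point functions with E^p inserted, which
    [dopmul_epow] evaluates. *)
Lemma trace_dopmul_pow v x p :
  \tr (dopmul x v *m U ^+ p) = \tr (dopmul v (x *m U ^+ p)) +
  \sum_(0 <= j < p)
    (bform (epow j *m opmul x *m G *m U ^+ (p - 1 - j) *m opmul v) D -
     bform (v *m U ^+ j *m opmul x *m G *m U ^+ (p - 1 - j)) D).
Proof.
have := congr1 mxtrace (dopmul_associativity v x (epow p)).
rewrite opmul_epow 2![\tr (_ + _)]linearD /= trace_opmul.
rewrite [\tr (U ^+ p *m _)]mxtrace_mulC [dopmul v x]dopmulC.
move=> /esym/(canRL (addKr _)) ->; rewrite addrCA; congr (_ + _).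
rewrite (dopmulC v (epow p)) dopmulC3 !(dopmulC (epow p)).
(* The commutator sum that is traced directly against [opmul x] vanishes; only its companion under
   [opmul] survives. *)
rewrite !dopmul_epow mulmxBr bformBl mulmxBl linearB /= trace_pow_commutator.
rewrite sub0r opprK -opmulM trace_opmul opmulC.
rewrite [v *m opmul _]opmulC /pow_commutator !(mulmx_suml, mulmx_sumr).
rewrite !bform_suml -sumrB -big_split.
apply: eq_big_nat => j lt_j /=.
rewrite /grading_commutator !(mulmxBr, mulmxBl) !bformBl !mulmxA.
rewrite -!/(epow j) [epow j *m opmul v]opmulC opmul_epow.
have -> u w z : u *m opmul w *m U ^+ (p - 1 - j) *m opmul z =
    u *m opmul z *m U ^+ (p - 1 - j) *m opmul w.
  rewrite -!mulmxA !pow_opmul_comm; congr (u *m _).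
  by rewrite mulmxA opmul_comm -mulmxA.
have -> : v *m U ^+ j *m G *m U ^+ (p - 1 - j) *m opmul x =
    v *m U ^+ j *m G *m opmul x *m U ^+ (p - 1 - j).
  by rewrite -[LHS]mulmxA pow_opmul_comm mulmxA.
ring.
Qed.

(** The three factors that vary are the coefficients of G(E^m), the structure constants and U^p. The
    commutator part of the last has trace zero against a multiplication. *)
Lemma d_trace_grading a m p :
  d a (\tr (opmul (epow m *m G) *m U ^+ p)) =
  bform (map_mx (d a) (epow m) *m G *m U ^+ p) D +
  \tr (dopmul (delta_mx 0 a) (epow m *m G) *m U ^+ p) +
  bform (epow m *m G *m opmul (delta_mx 0 a) *m U ^+ (p - 1)) D *+ p.
Proof.
rewrite derivation_trace map_d_mul map_d_opmul map_d_mul d_grading mulmx0 addr0.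
rewrite mulmxDl !linearD /= trace_opmul_pow; congr (_ + _).
rewrite map_d_pow mulmxDr linearD /= [X in _ + X]mxtrace_mulC.
rewrite trace_pow_commutator addr0 (raddfMn (mulmx _)) raddfMn /=.
by rewrite mulmxA -opmul_delta opmul_comm -opmulM trace_opmul_pow.
Qed.

Lemma bform_d_epow a m p :
  bform (map_mx (d a) (epow m) *m G *m U ^+ p) D =
  (bform (delta_mx 0 a *m U ^+ (m - 1)) (D *m U ^+ p) -
   bform (delta_mx 0 a *m U ^+ (m - 1)) (D *m U ^+ p *m G)) *+ m +
  \sum_(0 <= j < m)
   ((bform (epow j *m G *m P a *m U ^+ (m - 1 - j)) (D *m U ^+ p) -
     bform (epow j *m G *m P a *m U ^+ (m - 1 - j)) (D *m U ^+ p *m G)) -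
    (bform (epow j *m P a *m G *m U ^+ (m - 1 - j)) (D *m U ^+ p) -
     bform (epow j *m P a *m G *m U ^+ (m - 1 - j)) (D *m U ^+ p *m G))).
Proof.
rewrite bform_pow bform_grading map_d_epow !bformDl !bformMnl mulrnBl opprD addrACA.
congr (_ + _); rewrite /pow_commutator mulmx_sumr !bform_suml -sumrB.
apply: eq_big_nat => j lt_j; rewrite /grading_commutator opmul_delta.
by rewrite !(mulmxBr, mulmxBl) !mulmxA -/(epow j) !bformBl; ring.
Qed.

(** The first n odd numbers add up to n^2. These are the weights of the pairings without a grading,
    which therefore drop out. *)
Lemma sum_odd_sub n : \sum_(0 <= j < n) ((2 * j + 1)%:R - n%:R) = 0 :> S.
Proof.
have sum_odd : \sum_(0 <= j < n) (2 * j + 1)%:R = (n * n)%:R :> S.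
  elim: n => [|n IH]; first by rewrite big_geq.
  by rewrite big_nat_recr //= IH -natrD; congr _%:R; lia.
by rewrite sumrB sum_odd sumr_const_nat subn0 -mulrnA subrr.
Qed.

(** For a single m nothing simplifies. Summed over m, the corrections of [bform_d_epow] and of
    [trace_dopmul_pow] become sums over the same triples of exponents, and most of them cancel. *)
Lemma sum_d_trace_grading a n (x := delta_mx 0 a : 'rV[S]_N) :
  \sum_(0 <= m < n.+1) d a (\tr (opmul (epow m *m G) *m U ^+ (n - m))) =
  \sum_(0 <= m < n.+1) \tr (dopmul (epow m *m G) (x *m U ^+ (n - m))) +
  \sum_(0 <= m < n)
    bform (epow m *m G *m opmul x *m U ^+ (n - m - 1)) D *+ (n - m) +
  trisum n (fun i j l =>
    bform (epow j *m opmul x *m G *m U ^+ l *m opmul (epow i *m G)) D) +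
  trisum n (fun i j l =>
    bform (epow i *m opmul x *m G *m U ^+ j) (D *m U ^+ l *m G)) -
  \sum_(0 <= j < n) ((2 * j + 1)%:R - n%:R) *
    bform (x *m U ^+ j) (D *m U ^+ (n - 1 - j) *m G).
Proof.
under eq_bigr => m _ do
  rewrite d_trace_grading bform_d_epow trace_dopmul_pow -opmul_delta -/x.
rewrite !big_split /=.
rewrite (trisum_outer_last n (fun j q p =>
   (bform (epow j *m G *m opmul x *m U ^+ q) (D *m U ^+ p) -
     bform (epow j *m G *m opmul x *m U ^+ q) (D *m U ^+ p *m G)) -
    (bform (epow j *m opmul x *m G *m U ^+ q) (D *m U ^+ p) -
     bform (epow j *m opmul x *m G *m U ^+ q) (D *m U ^+ p *m G)))).
rewrite (trisum_outer_fst n (fun i j l =>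
  bform (epow j *m opmul x *m G *m U ^+ l *m opmul (epow i *m G)) D -
  bform (epow i *m G *m U ^+ j *m opmul x *m G *m U ^+ l) D)).
rewrite [X in _ + X = _]big_nat_recr //= subnn mulr0n addr0.
rewrite [X in X + _ + _ + _ = _]big_nat_recl //= mulr0n add0r.
set dops := \sum_(0 <= i < n.+1) \tr _.
set quad := \sum_(0 <= i < n) bform (_ *m opmul x *m _) D *+ _.
(* With no grading in between, the powers of U merge, so f is the common value of all these
   pairings; [h j] is the analogue with one grading and does depend on j. *)
pose f := bform x (D *m U ^+ (n - 1)).
pose h j := bform (x *m U ^+ j) (D *m U ^+ (n - 1 - j) *m G).
have bform_x j : (j < n)%N -> bform (x *m U ^+ j) (D *m U ^+ (n - 1 - j)) = f.
  by move=> lt_j; rewrite bform_pow -(mulmxA D) powD subnK //; lia.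
have tri_eq : trisum n (fun j q p =>
     bform (epow j *m G *m opmul x *m U ^+ q) (D *m U ^+ p) -
     bform (epow j *m G *m opmul x *m U ^+ q) (D *m U ^+ p *m G) -
     (bform (epow j *m opmul x *m G *m U ^+ q) (D *m U ^+ p) -
      bform (epow j *m opmul x *m G *m U ^+ q) (D *m U ^+ p *m G))) +
   trisum n (fun i j l =>
      bform (epow j *m opmul x *m G *m U ^+ l *m opmul (epow i *m G)) D -
      bform (epow i *m G *m U ^+ j *m opmul x *m G *m U ^+ l) D) =
  trisum n (fun i j l =>
     bform (epow j *m opmul x *m G *m U ^+ l *m opmul (epow i *m G)) D) +
  trisum n (fun i j l =>
     bform (epow i *m opmul x *m G *m U ^+ j) (D *m U ^+ l *m G)) -
  \sum_(0 <= j < n) (f - h j) *+ (n - j).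
  (* The terms with the grading next to E^i and then [opmul x] cancel between the two sums. *)
  rewrite -trisum_fst -trisumN -!trisumD; apply: eq_trisum => i j l ijl.
  have -> : bform (epow i *m G *m U ^+ j *m opmul x *m G *m U ^+ l) D =
      bform (epow i *m G *m opmul x *m U ^+ j) (D *m U ^+ l) -
      bform (epow i *m G *m opmul x *m U ^+ j) (D *m U ^+ l *m G).
    by rewrite bform_pow bform_grading -(mulmxA _ (U ^+ j)) pow_opmul_comm mulmxA.
  have -> : bform (epow i *m opmul x *m G *m U ^+ j) (D *m U ^+ l) = f - h i.
    rewrite bform_pow -(mulmxA D) powD bform_grading opmulC opmul_epow.
    by have -> : (l + j = n - 1 - i)%N; [lia | rewrite bform_x //; lia].
  ring.
have shift_eq : \sum_(0 <= i < n)
     (bform (x *m U ^+ (i.+1 - 1)) (D *m U ^+ (n - i.+1)) -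
      bform (x *m U ^+ (i.+1 - 1)) (D *m U ^+ (n - i.+1) *m G)) *+ i.+1 =
    \sum_(0 <= j < n) (f - h j) *+ (n - j) -
    \sum_(0 <= j < n) ((2 * j + 1)%:R - n%:R) * h j.
  (* The weight j + 1 differs from n - j by 2j + 1 - n; in this difference the part with f sums to
     zero and only [h j] remains. *)
  have f0 : \sum_(0 <= j < n) ((2 * j + 1)%:R - n%:R) * f = 0.
    by rewrite -mulr_suml sum_odd_sub mul0r.
  rewrite -[LHS]subr0 -[X in _ - X = _]f0 -!sumrB.
  apply: eq_big_nat => j lt_j.
  have -> : (j.+1 - 1 = j)%N by lia.
  have -> : (n - j.+1 = n - 1 - j)%N by lia.
  rewrite bform_x // -/(h j) -!(mulr_natr (f - h j)) natrB; last by lia.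
  by rewrite -natr1 natrD natrM; ring.
have regroup s1 s2 s3 s4 s5 s6 s7 s8 : s2 + s3 = s6 + s7 - s8 :> S ->
    s8 - s1 + s2 + (s4 + s3) + s5 = s4 + s5 + s6 + s7 - s1.
  by move=> e; rewrite (_ : s2 = s6 + s7 - s8 - s3); [ring | rewrite -e; ring].
by rewrite shift_eq; apply: regroup.
Qed.

(* Cyclicity of the trace cancels the terms with three gradings. *)
Lemma sum_d_trace_quadratic a n (x := delta_mx 0 a : 'rV[S]_N) :
  \sum_(0 <= m < n.+1) d a (\tr (G *m U ^+ m *m G *m U ^+ (n - m))) =
  2 * \sum_(0 <= m < n.+1)
        \tr (U ^+ (n - m) *m G *m U ^+ (m - 1) *m opmul x *m G) *+ m.
Proof.
pose t m := \tr (G *m map_mx (d a) (U ^+ m) *m G *m U ^+ (n - m)).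
transitivity (2 * \sum_(0 <= m < n.+1) t m).
  rewrite mulr_natl mulr2n [X in _ + X]sum_nat_rev -big_split.
  apply: eq_big_nat => m lt_m; rewrite derivation_trace !map_d_mul d_grading.
  rewrite mul0mx add0r mulmx0 addr0 linearD /=; congr (_ + _).
  rewrite /t (_ : n - (n.+1 - 1 - m) = m)%N; last by lia.
  rewrite (_ : n.+1 - 1 - m = n - m)%N; last by lia.
  by rewrite -!mulmxA [RHS]mxtrace_mulC -!mulmxA [RHS]mxtrace_mulC !mulmxA.
congr (_ * _); rewrite /t.
transitivity (\sum_(0 <= m < n.+1)
    (\tr (U ^+ (n - m) *m G *m U ^+ (m - 1) *m opmul x *m G) *+ m +
     \sum_(0 <= j < m)
       (\tr (G *m U ^+ j *m G *m opmul x *m U ^+ (m - 1 - j) *m G *m U ^+ (n - m)) -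
        \tr (G *m U ^+ j *m opmul x *m G *m U ^+ (m - 1 - j) *m G *m U ^+ (n - m))))).
  apply: eq_big_nat => m lt_m.
  rewrite map_d_pow mulmxDr !mulmxDl linearD /= -/x; congr (_ + _).
    rewrite -opmul_delta -/x -pow_opmul_comm (raddfMn (mulmx G)) /= -scaler_nat.
    rewrite -!scalemxAl linearZ /= mulr_natl; congr (_ *+ _).
    by rewrite mxtrace_mulC !mulmxA.
  rewrite /pow_commutator mulmx_sumr !mulmx_suml linear_sum.
  apply: eq_bigr => j _ /=; rewrite /grading_commutator.
  by rewrite !(mulmxBr, mulmxBl) !mulmxA linearB.
rewrite big_split /= -[RHS]addr0; congr (_ + _).
rewrite (trisum_outer_last n (fun j q p =>
   \tr (G *m U ^+ j *m G *m opmul x *m U ^+ q *m G *m U ^+ p) -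
   \tr (G *m U ^+ j *m opmul x *m G *m U ^+ q *m G *m U ^+ p))).
rewrite trisumD trisumN; apply/eqP; rewrite subr_eq0; apply/eqP.
rewrite [RHS]trisumCr [RHS]trisumCl.
apply: eq_trisum => i j l _.
rewrite -[in RHS](mulmxA G (U ^+ j)) pow_opmul_comm -!mulmxA [LHS]mxtrace_mulC.
by rewrite -!mulmxA [LHS]mxtrace_mulC -!mulmxA.
Qed.

(** * The derivative in operator form *)

Variable Hinv : 'M[S]_N.
Hypothesis mulHinv : Hinv *m H = 1%:M.

(** Multiplication is self-adjoint, so the trace with G equals the trace with its adjoint 1 - G; the
    two add up to the trace of M_v. *)
Lemma trace_grading v : 2 * \tr (G *m opmul v) = bform v D.
Proof.
have mulHHinv : H *m Hinv = 1%:M by apply: mulmx1C.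
have -> : 2 * \tr (G *m opmul v) =
    \tr (G *m opmul v) + \tr (opmul v *m G).
  by rewrite [X in _ + X]mxtrace_mulC; ring.
have -> : \tr (opmul v *m G) = \tr (H *m G^T *m Hinv *m opmul v).
  rewrite -mxtrace_tr trmx_mul -[in RHS](mulmx1 (opmul v)) -mulHHinv.
  rewrite [opmul v *m _]mulmxA opmul_adj -2!mulmxA [RHS]mxtrace_mulC -!mulmxA.
  by rewrite mulHinv mulmx1 (mulmxA Hinv) mulHinv mul1mx.
have G_split : G + H *m G^T *m Hinv = 1%:M.
  by rewrite -{1}(mulmx1 G) -mulHHinv mulmxA -mulmxDl grading_adj.
by rewrite -linearD -mulmxDl G_split mul1mx /= trace_opmul.
Qed.

Definition triple u v w : S := bform (u *m opmul v) w.

Lemma tripleAC u v w : triple u v w = triple u w v.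
Proof. by rewrite /triple bform_opmul opmulC -bform_opmul. Qed.

(** Summing over a pair of dual bases is a trace. The grading applied to gamma_b enters through its
    adjoint 1 - G, whence the difference. *)
Lemma sum_gup_grading w x m (A := U ^+ m *m G *m opmul (w *m opmul x)) :
  \sum_b triple (epow m *m opmul (\row_c Hinv c b) *m G *m
                  opmul (delta_mx 0 b *m G)) w x =
  \tr A - \tr (A *m G).
Proof.
transitivity (\sum_b (Hinv^T *m A *m H *m G^T) b b).
  apply: eq_bigr => b _.
  set g := \row_c Hinv c b.
  have -> : triple (epow m *m opmul g *m G *m opmul (delta_mx 0 b *m G)) w x =
      bform (g *m A) (delta_mx 0 b *m G).
    rewrite /triple bform_opmul [X in bform X _]opmulC bform_opmul bformC.
    rewrite [X in bform X _]opmulC [epow m *m _]opmulC opmul_epow.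
    by rewrite [x *m _]opmulC !mulmxA.
  have gE : g = delta_mx 0 b *m Hinv^T.
    by rewrite -rowE; apply/rowP => c; rewrite !mxE.
  have -> B : B b b = (delta_mx 0 b *m B *m (delta_mx 0 b)^T : 'M[S]_1) 0 0.
    by rewrite -rowE trmx_delta -colE !mxE.
  by rewrite /bform trmx_mul gE !mulmxA.
have mulHHinv : H *m Hinv^T = 1%:M.
  by rewrite -(trmxK H) -trmx_mul trH mulHinv trmx1.
have HG : H *m G^T *m Hinv^T = 1%:M - G.
  apply/eqP; rewrite eq_sym subr_eq -[G in _ + G]mulmx1 -mulHHinv mulmxA.
  by rewrite -mulmxDl addrC grading_adj.
rewrite -/(mxtrace _) -!(mulmxA Hinv^T) mxtrace_mulC -!(mulmxA A) HG.
by rewrite mulmxBr mulmx1 linearB.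
Qed.

Variable b0 : S.
Hypothesis grading_one : one *m G = b0 *: one.

(** The identity is the zeroth power of E, whose sum of commutators is empty. *)
Lemma dopmul_one v : dopmul v one = 0.
Proof.
have -> : one = epow 0 by rewrite /epow expr0 mulmx1.
by rewrite dopmul_epow /pow_commutator big_geq // mulmx0 linear0 subr0.
Qed.

Lemma dopmulZl s u v : dopmul (s *: u) v = s *: dopmul u v.
Proof.
rewrite !(dopmul_sum _ v) scaler_sumr; apply: eq_bigr => a _.
by rewrite mxE scalerA.
Qed.

Lemma derivationN a s : d a (- s) = - d a s.
Proof. by apply: (addrI (d a s)); rewrite -dD !subrr derivation0. Qed.

Lemma derivation_natmul a n s : d a (n%:R * s) = n%:R * d a s.
Proof.
rewrite !mulr_natl; elim: n => [|n IH]; first by rewrite !mulr0n derivation0.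
by rewrite !mulrS dD IH.
Qed.

Lemma epow_opmul m x : epow m *m opmul x = x *m U ^+ m.
Proof. by rewrite opmulC opmul_epow. Qed.

(** The argument of [d a] is 24 Phi_k in operator form. The first trace sum produces the first five
    lines on the right; the other two traces together produce the last two. *)
Lemma d_genus1 a k (x := delta_mx 0 a : 'rV[S]_N) : (0 < k)%N ->
  d a (- \sum_(0 <= m < k) \tr (opmul (epow m *m G) *m U ^+ (k - 1 - m))
       - 6%:R * \sum_(0 <= m < k) \tr (G *m U ^+ m *m G *m U ^+ (k - 1 - m))
       + (2 * k)%:R * \tr (U ^+ (k - 1))) =
    - (\sum_(1 <= i < k)
         \tr (dopmul (epow i *m G) (epow (k - i - 1) *m opmul x)))
    - (\sum_(0 <= i < k.-1)
         (k - i - 1)%:R *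
         triple (epow i *m G *m opmul (epow (k - i - 2))) D x)
    + (\sum_(0 <= i < k.-1)
         ((2 * i + 2)%:R - k%:R) *
         triple (D *m opmul (epow (k - i - 2)) *m G) (epow i) x)
    - (\sum_(1 <= i < k) \sum_(1 <= j < i.+1)
         triple (epow (k - i - 1) *m opmul D *m G)
                (epow (i - j) *m opmul x *m G) (epow j.-1))
    - (\sum_(1 <= i < k) \sum_(1 <= j < i.+1)
         triple (epow (k - i - 1) *m G *m opmul D)
                (epow (i - j) *m opmul x *m G) (epow j.-1))
    + 12%:R * (\sum_(1 <= i < k) i%:R * \sum_b
         triple (epow (k - i - 1) *m opmul (\row_c Hinv c b) *m G *m
                 opmul (delta_mx 0 b *m G)) (epow i.-1) x)
    - (k * (k - 1))%:R * triple D (epow (k - 2)) x.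
Proof.
case: k => // n _.
have subnn' m : (n.+1 - 1 - m = n - m)%N by lia.
under eq_bigr do rewrite subnn'.
under [X in - _ - _ * X]eq_bigr do rewrite subnn'.
rewrite !dD !derivationN !derivation_natmul derivation_sum
  [d a (\sum_(_ <= _ < _) \tr (G *m _ *m _ *m _))]derivation_sum
  sum_d_trace_grading sum_d_trace_quadratic -/x.
have -> : \sum_(0 <= m < n.+1) \tr (dopmul (epow m *m G) (x *m U ^+ (n - m))) =
    \sum_(1 <= i < n.+1)
      \tr (dopmul (epow i *m G) (epow (n.+1 - i - 1) *m opmul x)).
  (* The range on the right starts at 1 because the identity is an eigenvector of G and kills the
     four-point operator. *)
  rewrite big_ltn // [epow 0]/epow expr0 mulmx1 grading_one dopmulZl.
  rewrite dopmulC dopmul_one scaler0 linear0 add0r.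
  apply: eq_big_nat => i lt_i; rewrite epow_opmul.
  by have -> : (n.+1 - i - 1 = n - i)%N by lia.
set R1 := \sum_(1 <= i < n.+1) _.
have -> : \sum_(0 <= m < n)
    bform (epow m *m G *m opmul x *m U ^+ (n - m - 1)) D *+ (n - m) =
  \sum_(0 <= i < n.+1.-1) (n.+1 - i - 1)%:R *
    triple (epow i *m G *m opmul (epow (n.+1 - i - 2))) D x.
  apply: eq_big_nat => i lt_i; rewrite tripleAC /triple opmul_epow mulr_natl.
  have [-> ->] : (n.+1 - i - 1 = n - i)%N /\ (n.+1 - i - 2 = n - i - 1)%N by lia.
  by rewrite -!(mulmxA (epow i *m G)) pow_opmul_comm.
set R2 := \sum_(0 <= i < n.+1.-1) _.
have -> : \sum_(0 <= j < n) ((2 * j + 1)%:R - n%:R) *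
    bform (x *m U ^+ j) (D *m U ^+ (n - 1 - j) *m G) =
  \sum_(0 <= i < n.+1.-1) ((2 * i + 2)%:R - n.+1%:R) *
    triple (D *m opmul (epow (n.+1 - i - 2)) *m G) (epow i) x.
  apply: eq_big_nat => i lt_i; rewrite /triple !opmul_epow bform_pow.
  have -> : (n.+1 - i - 2 = n - 1 - i)%N by lia.
  by rewrite bform_pow bformC bform_pow; congr (_ * _); rewrite -!natr1 !natrD; ring.
set R3 := \sum_(0 <= i < n.+1.-1) ((_ + _)%:R - _) * _.
have -> : trisum n (fun i j l =>
    bform (epow i *m opmul x *m G *m U ^+ j) (D *m U ^+ l *m G)) =
  \sum_(1 <= i < n.+1) \sum_(1 <= j < i.+1)
    triple (epow (n.+1 - i - 1) *m opmul D *m G)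
           (epow (i - j) *m opmul x *m G) (epow j.-1).
  rewrite (trisum_shifted n.+1 (fun i j l => triple (epow i *m opmul D *m G)
    (epow j *m opmul x *m G) (epow l))) /= [RHS]trisumCl [RHS]trisumCr.
  apply: eq_trisum => i j l _.
  by rewrite tripleAC /triple !epow_opmul opmul_epow [RHS]bformC bform_pow.
set R4 := \sum_(1 <= i < n.+1) _.
have -> : trisum n (fun i j l =>
    bform (epow j *m opmul x *m G *m U ^+ l *m opmul (epow i *m G)) D) =
  \sum_(1 <= i < n.+1) \sum_(1 <= j < i.+1)
    triple (epow (n.+1 - i - 1) *m G *m opmul D)
           (epow (i - j) *m opmul x *m G) (epow j.-1).
  rewrite (trisum_shifted n.+1 (fun i j l => triple (epow i *m G *m opmul D)
    (epow j *m opmul x *m G) (epow l))) /=.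
  apply: eq_trisum => i j l _.
  rewrite tripleAC /triple opmul_epow bform_opmul [RHS]bformC bform_pow.
  by rewrite [D *m _]opmulC.
set R5 := \sum_(1 <= i < n.+1) _.
set f := bform (x *m U ^+ (n - 1)) D.
have -> : triple D (epow (n.+1 - 2)) x = f.
  by rewrite /triple opmul_epow bform_pow bformC.
have -> : d a (\tr (U ^+ (n.+1 - 1))) = n%:R * f.
  rewrite derivation_trace map_d_pow linearD linearMn /= -[pow_commutator _ _]mulmx1.
  rewrite -opmul_one trace_pow_commutator addr0 -opmul_delta trace_opmul_pow.
  by rewrite (_ : n.+1 - 1 = n)%N ?mulr_natl; last by lia.
set quad := \sum_(0 <= m < n.+1) _.
set R6 := \sum_(1 <= i < n.+1) _.
(* One factor 2 clears the denominator in the sum of the i, the other is the one in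
   [trace_grading]. *)
have four_R6 : 2 * (2 * R6) = (n.+1 * n)%:R * f - 2 * (2 * quad).
  have sum_i : 2 * \sum_(1 <= i < n.+1) i%:R = (n.+1 * n)%:R :> S.
    elim: (n) => [|p IH]; first by rewrite big_geq // mulr0.
    by rewrite big_nat_recr //= mulrDr IH -natrM -natrD; congr _%:R; lia.
  rewrite /quad big_ltn // mulr0n add0r -sum_i -mulrA mulr_suml -mulrBr.
  congr (2 * _); rewrite !mulr_sumr -sumrB; apply: eq_big_nat => i lt_i.
  rewrite sum_gup_grading.
  have -> : opmul (epow i.-1 *m opmul x) = U ^+ (i - 1) *m opmul x.
    by rewrite opmulM opmul_epow pow_opmul_comm subn1.
  have -> : (n.+1 - i - 1 = n - i)%N by lia.
  rewrite !mulmxA; set t := \tr (_ *m G).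
  have -> : f = 2 * \tr (U ^+ (n - i) *m G *m U ^+ (i - 1) *m opmul x).
    rewrite -!(mulmxA (U ^+ (n - i))) mxtrace_mulC -!mulmxA opmul_pow.
    rewrite -(opmul_epow (i - 1)) -opmulM trace_grading opmul_epow -mulmxA powD /f.
    by have -> : (n - 1 = n - i + (i - 1))%N by lia.
  by rewrite -[t *+ i]mulr_natl; ring.
(* Here 12 is split as 3 times 4, so that [four_R6] applies without dividing. *)
transitivity (- R1 - R2 + R3 - R4 - R5 + 3 * (2 * (2 * R6)) -
    (n.+1 * (n.+1 - 1))%:R * f).
  by rewrite four_R6 subn1 /= !natrM -!natr1; ring.
by ring.
Qed.
End FrobeniusCalculus.

(** * Structure constants of a conformal Frobenius algebra *)

Section StructureConstants.
Variables (S : comNzRingType) (r : nat).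
Local Notation N := r.+1.
Implicit Types (a b c x y z : 'I_N).

Variable d : 'I_N -> S -> S.
Hypothesis dD : forall a, {morph d a : s t / s + t}.
Hypothesis dM : forall a s t, d a (s * t) = d a s * t + s * d a t.

Variable F3 : 'I_N -> 'I_N -> 'I_N -> S.
Hypothesis F3Cl : forall a b c, F3 a b c = F3 b a c.
Hypothesis F3Cr : forall a b c, F3 a b c = F3 a c b.
Hypothesis d_F3 : forall a b c x, d a (F3 b c x) = d b (F3 a c x).

Variables H Hinv : 'M[S]_N.
Hypothesis trH : H^T = H.
Hypothesis mulHinv : Hinv *m H = 1%:M.
Hypothesis d_Hinv : forall a b c, d a (Hinv b c) = 0.
Hypothesis F3_wdvv : forall a b c x,
  \sum_y \sum_z Hinv y z * (F3 a b y * F3 z c x) =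
  \sum_y \sum_z Hinv y z * (F3 a c y * F3 z b x).
Hypothesis F3_one : forall a b, F3 ord0 a b = H a b.

Variable wt : 'I_N -> S.
Hypothesis d_wt : forall a b, d a (wt b) = 0.
Hypothesis wtH : forall a b, (wt a + wt b) * H a b = H a b.

Variable E : 'rV[S]_N.
Hypothesis d_E : forall a b, d a (E 0 b) = (a == b)%:R * (wt ord0 + 1 - wt b).
Hypothesis F3_homogeneous : forall a x y,
  \sum_b E 0 b * d b (F3 a x y) =
  (wt a + wt x + wt y - (wt ord0 + 1)) * F3 a x y.

(** Row x holds the coefficients of gamma_b o gamma_x, as required for operators acting on rows from
    the right. *)
Definition opbase b : 'M[S]_N := \matrix_(x, y) \sum_z F3 b x z * Hinv z y.
Definition grading : 'M[S]_N := diag_mx (\row_a wt a).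
(** The vector Delta, known in two-dimensional field theory as the handle element. *)
Definition handle_vector : 'rV[S]_N :=
  \sum_a ((\row_b Hinv b a) *m opmul opbase (delta_mx 0 a)).

Lemma opbaseE b : opbase b = (\matrix_(x, y) F3 b x y) *m Hinv.
Proof. by apply/matrixP => x y; rewrite !mxE; apply: eq_bigr => z _; rewrite mxE. Qed.

Lemma opbase_gram b : opbase b *m H = \matrix_(x, y) F3 b x y.
Proof. by rewrite opbaseE -mulmxA mulHinv mulmx1. Qed.

Lemma trHinv : Hinv^T = Hinv.
Proof.
have HV := mulmx1C mulHinv.
by rewrite -[LHS]mul1mx -mulHinv -mulmxA -{1}trH -trmx_mul mulHinv trmx1 mulmx1.
Qed.

Lemma opbase_adj a : opbase a *m H = H *m (opbase a)^T.
Proof.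
rewrite -{2}trH -trmx_mul opbase_gram.
by apply/matrixP => x y; rewrite !mxE F3Cr.
Qed.

Lemma row_opbase a b : row a (opbase b) = row b (opbase a).
Proof.
by apply/rowP => y; rewrite !mxE; apply: eq_bigr => z _; rewrite F3Cl.
Qed.

(** Associativity of the quantum product is [F3_wdvv] with its last free index raised; the rest
    reorders finite sums. *)
Lemma opmul_row a b :
  opmul opbase (row a (opbase b)) = opbase b *m opbase a.
Proof.
apply/matrixP => x y; rewrite opmulE summxE.
transitivity (\sum_c (\sum_e \sum_z Hinv e z * (F3 b a e * F3 z x c)) * Hinv c y).
  transitivity (\sum_z \sum_c \sum_e Hinv e z * (F3 b a e * F3 z x c) * Hinv c y).
    apply: eq_bigr => z _; rewrite !mxE mulr_suml exchange_big /=.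
    apply: eq_bigr => e _; rewrite mulr_sumr; apply: eq_bigr => c _.
    by ring.
  rewrite exchange_big; apply: eq_bigr => c _ /=.
  rewrite exchange_big mulr_suml; apply: eq_bigr => e _ /=.
  by rewrite mulr_suml.
under eq_bigr do rewrite F3_wdvv.
rewrite mxE.
transitivity (\sum_z \sum_c \sum_e Hinv e z * (F3 b x e * F3 z a c) * Hinv c y).
  rewrite [RHS]exchange_big; apply: eq_bigr => c _ /=.
  rewrite [RHS]exchange_big mulr_suml; apply: eq_bigr => e _ /=.
  by rewrite mulr_suml.
apply: eq_bigr => z _; rewrite !mxE mulr_suml exchange_big /=.
apply: eq_bigr => e _; rewrite mulr_sumr; apply: eq_bigr => c _.
by rewrite (F3Cl z a); ring.
Qed.

Lemma map_d_opbaseE a b :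
  map_mx (d a) (opbase b) = (\matrix_(x, y) d a (F3 b x y)) *m Hinv.
Proof.
apply/matrixP => x y; rewrite !mxE (derivation_sum dD); apply: eq_bigr => z _.
by rewrite dM d_Hinv mulr0 addr0 mxE.
Qed.

Lemma d_opbase a b : map_mx (d a) (opbase b) = map_mx (d b) (opbase a).
Proof.
by rewrite !map_d_opbaseE; congr (_ *m _); apply/matrixP => x y; rewrite !mxE d_F3.
Qed.

Lemma one_opbase a : (delta_mx 0 ord0 : 'rV[S]_N) *m opbase a = delta_mx 0 a.
Proof.
rewrite -rowE row_opbase rowE opbaseE.
have -> : \matrix_(x, y) F3 ord0 x y = H by apply/matrixP => x y; rewrite mxE F3_one.
by rewrite (mulmx1C mulHinv) mulmx1.
Qed.

Lemma d_delta a b : map_mx (d a) (delta_mx 0 b : 'rV[S]_N) = 0.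
Proof.
apply/rowP => c; rewrite !mxE /=; case: (c == b).
  exact: (derivation1 dM).
exact: (derivation0 dD).
Qed.

Lemma grading_adj : grading *m H + H *m grading^T = H.
Proof.
apply/matrixP => x y; rewrite mxE tr_diag_mx mul_diag_mx mul_mx_diag !mxE.
by rewrite [H x y * _]mulrC -mulrDl wtH.
Qed.

Lemma d_grading a : map_mx (d a) grading = 0.
Proof.
apply/matrixP => x y; rewrite !mxE.
by case: (x == y); rewrite ?mulr1n ?mulr0n ?d_wt // (derivation0 dD).
Qed.

(** The adjunction for the inverse form: raising an index replaces G by 1 - G. *)
Lemma grading_Hinv : grading *m Hinv = Hinv - Hinv *m grading.
Proof.
have HV := mulmx1C mulHinv.
apply/eqP; rewrite eq_sym subr_eq; apply/eqP.
rewrite -[in LHS](mulmx1 Hinv) -{1}HV -{1}grading_adj mulmxDl mulmxDr.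
rewrite -(mulmxA _ H) HV mulmx1 !mulmxA mulHinv mul1mx.
by rewrite tr_diag_mx addrC.
Qed.

(** By [d_opbase] the derivative of the structure constants becomes one along E, known from
    homogeneity. The scalar multiples of [opbase a] then cancel, and [grading_Hinv] leaves the
    commutator and one copy of [opbase a]. *)
Lemma map_d_euler a : map_mx (d a) (opmul opbase E) =
  opbase a + (grading *m opbase a - opbase a *m grading).
Proof.
have -> : map_mx (d a) (opmul opbase E) = (wt ord0 + 1 - wt a) *: opbase a +
    \sum_b E 0 b *: map_mx (d b) (opbase a).
  rewrite (map_d_opmul dD dM) (dopmul_delta d opbase); congr (_ + _).
    rewrite opmulE (bigD1 a) //= mxE d_E eqxx mul1r big1 ?addr0 // => b nba.
    by rewrite mxE d_E eq_sym (negbTE nba) mul0r scale0r.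
  by apply: eq_bigr => b _; rewrite d_opbase.
under eq_bigr do rewrite map_d_opbaseE scalemxAl.
rewrite -mulmx_suml.
have -> : \sum_b E 0 b *: \matrix_(x, y) d b (F3 a x y) =
    (wt a - (wt ord0 + 1)) *: (\matrix_(x, y) F3 a x y) +
    grading *m (\matrix_(x, y) F3 a x y) + (\matrix_(x, y) F3 a x y) *m grading.
  apply/matrixP => x y; rewrite mul_diag_mx mul_mx_diag summxE !mxE.
  transitivity (\sum_b E 0 b * d b (F3 a x y)).
    by apply: eq_bigr => b _; rewrite !mxE.
  by rewrite F3_homogeneous; ring.
rewrite !mulmxDl -scalemxAl -!mulmxA grading_Hinv mulmxBr !mulmxA -!opbaseE.
rewrite !addrA -scalerDl [_ + (wt a - _)](_ : _ = 0); last by ring.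
by rewrite scale0r add0r -(mulmxA grading) -opbaseE [opbase a + _]addrC.
Qed.

(** The diagonal entry at a is the pairing of v o gamma_a with gamma^a, that is, of v with gamma^a o
    gamma_a. *)
Lemma trace_opmul v : \tr (opmul opbase v) = bform H v handle_vector.
Proof.
rewrite (bformC trH) /handle_vector bform_suml.
transitivity (\sum_a (v *m opbase a) 0 a).
  rewrite /mxtrace; apply: eq_bigr => a _; rewrite opmulE summxE [RHS]mxE.
  apply: eq_bigr => b _; rewrite mxE; congr (_ * _).
  by have /rowP/(_ a) := row_opbase a b; rewrite !mxE.
apply: eq_bigr => a _.
rewrite (bform_opmul opbase_adj) opmul_delta.
have -> : (\row_b Hinv b a) = delta_mx 0 a *m Hinv.
  by rewrite -rowE -[in RHS]trHinv; apply/rowP => b; rewrite !mxE.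
by rewrite /bform -(mulmxA _ Hinv) mulHinv mulmx1 -rowE !mxE.
Qed.

(** * Brackets as matrix expressions *)

Local Notation V := ('rV[S]_N).
Variables (br3 : V -> V -> V -> S) (br4 : V -> V -> V -> V -> S).
Variables (qp : V -> V -> V) (Gop : V -> V) (gup : 'I_N -> V).
Variables (Ep : nat -> V) (D : V).
Local Notation glow a := (delta_mx 0 a : V).
Implicit Types u v w : V.
(* Abstract counterparts of bracket, qprod, .. over an arbitrary ring S. *)
Hypothesis br3E : forall u v w,
  br3 u v w = \sum_a \sum_b \sum_c u 0 a * v 0 b * w 0 c * F3 a b c.
Hypothesis br4E : forall u v w t, br4 u v w t =
  \sum_a \sum_b \sum_c \sum_x
    u 0 a * v 0 b * w 0 c * t 0 x * d a (F3 b c x).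
Hypothesis qpE : forall v w, qp v w = \sum_a br3 v w (gup a) *: glow a.
Hypothesis GopE : forall v, Gop v = \row_a (wt a * v 0 a).
Hypothesis gupE : forall a, gup a = \row_b Hinv b a.
Hypothesis Ep0 : Ep 0 = glow ord0.
Hypothesis EpS : forall k, Ep k.+1 = qp E (Ep k).
Hypothesis DE : D = \sum_a qp (gup a) (glow a).

Local Notation qop := (opmul opbase).
Local Notation one := (glow ord0).

Lemma br3_triple u v w : br3 u v w = triple opbase H u v w.
Proof.
rewrite /triple /bform br3E opmulE mulmx_sumr !mulmx_suml summxE.
rewrite exchange_big; apply: eq_bigr => b _.
rewrite -scalemxAr -!scalemxAl -(mulmxA u) opbase_gram !mxE exchange_big /=.
rewrite mulr_sumr; apply: eq_bigr => c _; rewrite !mxE mulr_suml mulr_sumr.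
by apply: eq_bigr => a _; rewrite mxE (F3Cl b a); ring.
Qed.

Lemma gup_delta a : gup a = glow a *m Hinv.
Proof. by rewrite gupE -rowE -[in RHS]trHinv; apply/rowP => b; rewrite !mxE. Qed.

Lemma br3_gup v w a : br3 v w (gup a) = (v *m qop w) 0 a.
Proof.
rewrite br3_triple /triple /bform gup_delta trmx_mul trHinv !mulmxA.
by rewrite -(mulmxA _ H) (mulmx1C mulHinv) mulmx1 trmx_delta -colE mxE.
Qed.

Lemma qp_opmul v w : qp v w = v *m qop w.
Proof.
rewrite qpE [RHS]row_sum_delta; apply: eq_bigr => a _.
by rewrite br3_gup.
Qed.

Lemma Gop_mul v : Gop v = v *m grading.
Proof. by rewrite GopE mul_mx_diag; apply/rowP => a; rewrite !mxE mulrC. Qed.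

Lemma Ep_epow k : Ep k = epow opbase one E k.
Proof.
elim: k => [|k IH]; first by rewrite Ep0 /epow expr0 mulmx1.
by rewrite EpS qp_opmul IH (epowS row_opbase).
Qed.

Lemma D_handle_vector : D = handle_vector.
Proof.
by rewrite DE /handle_vector; apply: eq_bigr => a _; rewrite qp_opmul gupE.
Qed.

Lemma br4_trace u v :
  \sum_x br4 u v (glow x) (gup x) = \tr (dopmul d opbase u v).
Proof.
transitivity (\sum_x \sum_a \sum_b \sum_y
    u 0 a * v 0 b * (Hinv y x * d a (F3 b x y))).
  apply: eq_bigr => x _; rewrite br4E; apply: eq_bigr => a _.
  apply: eq_bigr => b _; rewrite (bigD1 x) //= [X in _ + X]big1 ?addr0; last first.
    by move=> c /negbTE nc; rewrite big1 // => y _; rewrite !mxE eqxx nc /=; ring.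
  by apply: eq_bigr => y _; rewrite gupE !mxE !eqxx /=; ring.
rewrite exchange_big /dopmul linear_sum; apply: eq_bigr => a _ /=.
rewrite exchange_big linear_sum; apply: eq_bigr => b _ /=.
rewrite linearZ /= /mxtrace mulr_sumr; apply: eq_bigr => x _.
rewrite map_d_opbaseE mxE mulr_sumr; apply: eq_bigr => y _.
by rewrite mxE [Hinv y x * _]mulrC.
Qed.

Local Notation trU m := (opmul opbase E ^+ m).

(** The first bracket is the coefficient of E^m on gamma_a, so the sum over a builds G(E^m) o E^p;
    the sum over c is the trace of [opbase b]. *)
Lemma genus1_term1 m p :
  \sum_a \sum_b \sum_c wt a * br3 one (Ep m) (gup a) *
     br3 (glow a) (Ep p) (gup b) * br3 (glow b) (glow c) (gup c) =
  \tr (qop (epow opbase one E m *m grading) *m trU p).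
Proof.
rewrite (opmul_pow row_opbase opmul_row one_opbase) opmulE linear_sum exchange_big.
apply: eq_bigr => b _ /=; rewrite linearZ /= mxE mulr_suml.
apply: eq_bigr => a _; rewrite -mulr_sumr.
have -> : \sum_c br3 (glow b) (glow c) (gup c) = \tr (opbase b).
  apply: eq_bigr => c _; rewrite br3_gup (opmulC row_opbase) opmul_delta.
  by rewrite -rowE mxE.
congr (_ * _); rewrite !br3_gup !Ep_epow; congr (_ * _).
  rewrite -Gop_mul GopE mxE (opmulC row_opbase) (opmul_one row_opbase one_opbase).
  by rewrite mulmx1.
by rewrite (opmul_epow row_opbase opmul_row one_opbase) -rowE mxE.
Qed.

Lemma br3_pow a b m : br3 (glow a) (Ep m) (gup b) = (trU m) a b.
Proof.
rewrite br3_gup Ep_epow (opmul_epow row_opbase opmul_row one_opbase).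
by rewrite -rowE mxE.
Qed.

Lemma genus1_term2 m p :
  \sum_a \sum_b wt a * wt b * br3 (glow a) (Ep m) (gup b) *
     br3 (glow b) (Ep p) (gup a) =
  \tr (grading *m trU m *m grading *m trU p).
Proof.
apply: eq_bigr => a _; rewrite mul_diag_mx mxE; apply: eq_bigr => b _.
by rewrite mul_mx_diag !br3_pow !mxE; ring.
Qed.

Lemma genus1_term3 n : \sum_c br3 (glow c) (Ep n) (gup c) = \tr (trU n).
Proof. by apply: eq_bigr => c _; rewrite br3_pow. Qed.

Lemma grading_one : one *m grading = wt ord0 *: one.
Proof.
apply/rowP => b; rewrite mul_mx_diag !mxE eqxx /=.
by case: eqP => [->|]; rewrite ?mul0r ?mulr0 // mul1r mulr1.
Qed.

Lemma d_genus1_potential a k (ga := glow a) : (0 < k)%N ->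
  d a (- (\sum_(0 <= m < k) \sum_x \sum_y \sum_z
            wt x * br3 one (Ep m) (gup x) * br3 (glow x) (Ep (k - 1 - m)) (gup y) *
            br3 (glow y) (glow z) (gup z))
       - 6%:R * (\sum_(0 <= m < k) \sum_x \sum_y
            wt x * wt y * br3 (glow x) (Ep m) (gup y) *
            br3 (glow y) (Ep (k - 1 - m)) (gup x))
       + (2 * k)%:R * \sum_x br3 (glow x) (Ep (k - 1)) (gup x)) =
    - (\sum_(1 <= i < k) \sum_x
         br4 (Gop (Ep i)) (qp (Ep (k - i - 1)%N) ga) (glow x) (gup x))
    - (\sum_(0 <= i < k.-1)
         (k - i - 1)%:R * br3 (qp (Gop (Ep i)) (Ep (k - i - 2)%N)) D ga)
    + (\sum_(0 <= i < k.-1)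
         ((2 * i + 2)%:R - k%:R) *
         br3 (Gop (qp D (Ep (k - i - 2)%N))) (Ep i) ga)
    - (\sum_(1 <= i < k) \sum_(1 <= j < i.+1)
         br3 (Gop (qp (Ep (k - i - 1)%N) D)) (Gop (qp (Ep (i - j)%N) ga))
             (Ep j.-1))
    - (\sum_(1 <= i < k) \sum_(1 <= j < i.+1)
         br3 (qp (Gop (Ep (k - i - 1)%N)) D) (Gop (qp (Ep (i - j)%N) ga))
             (Ep j.-1))
    + 12%:R * (\sum_(1 <= i < k) i%:R * \sum_x
         br3 (qp (Gop (qp (Ep (k - i - 1)%N) (gup x))) (Gop (glow x)))
             (Ep i.-1) ga)
    - (k * (k - 1))%:R * br3 D (Ep (k - 2)%N) ga.
Proof.
move=> k_gt0.
under eq_bigr do rewrite genus1_term1.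
under [X in _ - _ * X]eq_bigr do rewrite genus1_term2.
rewrite genus1_term3.
rewrite (@d_genus1 _ _ d dD dM opbase row_opbase opmul_row d_opbase one one_opbase
  (fun a => d_delta a ord0) H grading trH opbase_adj grading_adj d_grading E
  map_d_euler handle_vector trace_opmul Hinv mulHinv _ grading_one a k k_gt0).
have E3 := br3_triple; have EV := (qp_opmul, Gop_mul, Ep_epow, D_handle_vector).
congr (- _ - _ + _ - _ - _ + _ * _ - _ * _).
- by apply: eq_bigr => i _; rewrite br4_trace !EV.
- by apply: eq_bigr => i _; rewrite E3 !EV.
- by apply: eq_bigr => i _; rewrite E3 !EV.
- by apply: eq_bigr => i _; apply: eq_bigr => j _; rewrite E3 !EV.
- by apply: eq_bigr => i _; apply: eq_bigr => j _; rewrite E3 !EV.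
- apply: eq_bigr => i _; congr (_ * _); apply: eq_bigr => x _.
  by rewrite E3 !EV gupE.
by rewrite E3 !EV.
Qed.
End StructureConstants.

(** * Exponential generating functions *)

Section TupleSums.
Variables (V : nmodType) (T : finType).

Lemma big_tuple0 (F : 0.-tuple T -> V) : \sum_(t : 0.-tuple T) F t = F [tuple].
Proof.
rewrite (bigD1 [tuple]) //= big1 ?addr0// => t /eqP[].
exact: tuple0.
Qed.

Lemma big_tupleS n (F : n.+1.-tuple T -> V) :
  \sum_(t : n.+1.-tuple T) F t = \sum_x \sum_(t : n.-tuple T) F [tuple of x :: t].
Proof.
rewrite pair_bigA /= (reindex (fun p : T * n.-tuple T => [tuple of p.1 :: p.2])) //.
exists (fun t : n.+1.-tuple T => (thead t, [tuple of behead t])) => [[x t] _|t _].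
  by rewrite theadE; congr pair; apply/val_inj.
by rewrite /= -tuple_eta.
Qed.
End TupleSums.

Section Series.
Variables (M : splitNmodType) (A : comNzRingType).
Implicit Types (f g : series M A) (m : M).

Lemma seriesME f g m : (f * g) m = \sum_(u <- splits m) f u.1 * g u.2.
Proof. by []. Qed.

Lemma seriesDE f g m : (f + g) m = f m + g m.
Proof. by []. Qed.

Lemma series_sumE (J : Type) (r : seq J) (F : J -> series M A) m :
  (\sum_(j <- r) F j) m = \sum_(j <- r) F j m.
Proof. exact: (big_morph (fun f : series M A => f m)). Qed.

Lemma seriesMnE f n m : (f *+ n) m = f m *+ n.
Proof. by elim: n => [|n IH] //; rewrite !mulrS seriesDE IH. Qed.

Lemma series_constM (a : A) f m :
  ((series_const a : series M A) * f) m = a * f m.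
Proof.
have m0 : (0, m) \in splits m by rewrite mem_splits /= add0r.
rewrite seriesME (bigD1_seq _ m0 (splits_uniq m)) /= /series_const eqxx.
rewrite big_seq_cond big1 ?addr0// => -[x y] /andP[]; rewrite mem_splits /=.
move=> /eqP <-; case: (eqVneq x 0) => [->|_ _]; last by rewrite mul0r.
by rewrite add0r eqxx.
Qed.

Fact series_const_is_additive :
  zmod_morphism (@series_const M A).
Proof.
move=> a b; apply/funext => m.
transitivity (@series_const M A a m - @series_const M A b m) => //.
by rewrite /series_const; case: ifP; rewrite ?subr0.
Qed.

Fact series_const_is_multiplicative :
  monoid_morphism (@series_const M A).
Proof.
split=> // a b; apply/funext => m; rewrite [RHS]series_constM /series_const.
by case: ifP; rewrite ?mulr0.
Qed.

HB.instance Definition _ :=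
  GRing.isZmodMorphism.Build A (series M A) (@series_const M A)
    series_const_is_additive.
HB.instance Definition _ :=
  GRing.isMonoidMorphism.Build A (series M A) (@series_const M A)
    series_const_is_multiplicative.
End Series.

Section PowerSeries.
Variables (I : finType) (A : comNzRingType).
Implicit Types (f g h : powser I A) (m : {ffun I -> nat}) (i j : I).

Lemma mnmD1E m i j : (m + mnm1 i) j = (m j + (j == i))%N.
Proof. by rewrite !ffunE. Qed.

Lemma mnm_addrI (a : {ffun I -> nat}) : injective (+%R a).
Proof.
by move=> b c /ffunP e; apply/ffunP => i; move: (e i); rewrite !ffunE => /addnI.
Qed.

Lemma mnm_addIr (a : {ffun I -> nat}) : injective (+%R^~ a).
Proof. by move=> b c; rewrite ![_ + a]addrC => /mnm_addrI. Qed.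

Lemma pvar_mulD i h m : (pvar A i * h) (m + mnm1 i) = h m.
Proof.
have mi : (mnm1 i, m) \in splits (m + mnm1 i) by rewrite mem_splits /= addrC.
rewrite seriesME (bigD1_seq _ mi (splits_uniq _)) /= /pvar eqxx mul1r.
rewrite big_seq_cond big1 ?addr0// => -[a b] /andP[]; rewrite mem_splits /=.
move=> /eqP e; case: (eqVneq a (mnm1 i)) => [ai|_ _]; last by rewrite mul0r.
by move: e; rewrite ai addrC => /mnm_addIr ->; rewrite eqxx.
Qed.

Lemma mnm_subK i m : (0 < m i)%N -> exists m', m = m' + mnm1 i.
Proof.
move=> mi; exists [ffun j => m j - (j == i)]%N; apply/ffunP => j.
by rewrite !ffunE; case: (eqVneq j i) mi => [->|_] /=; lia.
Qed.

Lemma pvar_mul0 i h m : m i = 0 -> (pvar A i * h) m = 0.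
Proof.
move=> mi; rewrite seriesME big_seq_cond big1 // => -[a b] /andP[].
rewrite mem_splits /= => /eqP e _; rewrite /pvar.
case: eqVneq => [ai|]; last by rewrite mul0r.
by move: mi; rewrite -e ai !ffunE eqxx.
Qed.

Lemma pvar_pderiv i f m : (pvar A i * pderiv i f) m = f m *+ m i.
Proof.
case: (posnP (m i)) => [mi|/mnm_subK[m' ->]].
  by rewrite pvar_mul0 // mi mulr0n.
by rewrite pvar_mulD /pderiv mnmD1E eqxx addn1.
Qed.

Lemma pderivD i f g : pderiv i (f + g) = pderiv i f + pderiv i g.
Proof. by apply/funext => m; rewrite /pderiv !seriesDE mulrnDl. Qed.

(** Multiplication by t^i only shifts coefficients, and t^i d_i multiplies the coefficient at m by
    m_i. This weight is additive in m, so the rule holds term by term in the convolution. *)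
Lemma pderivM i f g :
  pderiv i (f * g) = pderiv i f * g + f * pderiv i g.
Proof.
apply/funext => m; rewrite seriesDE.
rewrite -(pvar_mulD i (pderiv i f * g)) -(pvar_mulD i (f * pderiv i g)).
rewrite mulrA mulrCA /pderiv !seriesME -big_split -sumrMnl.
apply: eq_big_seq => -[a b] /=; rewrite mem_splits /= => /eqP e.
rewrite !pvar_pderiv mulrnAl mulrnAr -mulrnDr.
by congr (_ *+ _); have /ffunP/(_ i) := e; rewrite mnmD1E eqxx addn1 ffunE.
Qed.

Lemma pderivC i j f : pderiv i (pderiv j f) = pderiv j (pderiv i f).
Proof.
apply/funext => m; rewrite /pderiv addrAC -!mulrnA; congr (_ *+ _).
rewrite !mnmD1E; case: (eqVneq i j) => [->|_] //=.
by rewrite !addn0 mulnC.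
Qed.

Lemma pderiv_const i (a : A) : pderiv i (series_const a : powser I A) = 0.
Proof.
apply/funext => m; rewrite /pderiv /series_const.
have /negbTE -> : m + mnm1 i != 0; last by rewrite mul0rn.
by apply/eqP => /ffunP/(_ i); rewrite mnmD1E eqxx addn1 ffunE.
Qed.

Lemma pderiv_pvar i j : pderiv i (pvar A j) = (i == j)%:R.
Proof.
apply/funext => m.
have -> : ((i == j)%:R : powser I A) = series_const (i == j)%:R.
  by rewrite rmorph_nat.
rewrite /pderiv /pvar /series_const.
case: (eqVneq i j) => [<-|ij].
  rewrite -{2}(add0r (mnm1 i)) (inj_eq (@mnm_addIr _)).
  by case: eqP => [->|]; rewrite ?mul0rn // ffunE.
case: (eqVneq (m + mnm1 i) _) => [/ffunP/(_ i)|_]; last by rewrite mul0rn if_same.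
by rewrite mnmD1E !ffunE eqxx (negbTE ij) addn1.
Qed.

(** * Symmetric functions of words and their generating series *)

Definition content (s : seq I) : {ffun I -> nat} := [ffun i => count_mem i s].

Lemma content_cons i s : content (i :: s) = content s + mnm1 i.
Proof. by apply/ffunP => j; rewrite mnmD1E !ffunE /= addnC eq_sym. Qed.

Lemma content_eq s s' : (content s == content s') = perm_eq s s'.
Proof.
apply/eqP/idP => [e|/permP e]; last by apply/ffunP => i; rewrite !ffunE.
by apply/allP => i _ /=; have /ffunP/(_ i) := e; rewrite !ffunE => ->.
Qed.

(** A chosen word for each content, through which a symmetric function of words is read as a
    function of exponents. *)
Definition listing m : seq I := flatten [seq nseq (m i) i | i <- enum I].

Lemma content_listing m : content (listing m) = m.
Proof.
apply/ffunP => i; rewrite ffunE count_flatten -map_comp sumnE big_map big_enum /=.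
rewrite (bigD1 i) //= count_nseq /= eqxx mul1n big1 ?addn0// => j ji.
by rewrite count_nseq /= (negbTE ji).
Qed.

Definition mfact m : nat := (\prod_i (m i)`!)%N.

Lemma mfactS m i : mfact (m + mnm1 i) = ((m i).+1 * mfact m)%N.
Proof.
rewrite /mfact (bigD1 i) //= [in RHS](bigD1 i) //= mnmD1E eqxx addn1 factS mulnA.
congr (_ * _)%N; apply: eq_bigr => j ji; by rewrite mnmD1E (negbTE ji) addn0.
Qed.

(** The multinomial coefficient, by induction on the first letter: removing a letter i divides
    [mfact] by m_i and leaves a word of length k. *)
Lemma card_content k m : (\sum_i m i = k)%N ->
  (\sum_(t : k.-tuple I) (content t == m) * mfact m = k`!)%N.
Proof.
elim: k m => [|k IH] m sum_m.
  rewrite big_tuple0 /mfact.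
  have -> : m = 0.
    apply/ffunP => i; rewrite ffunE; apply/eqP.
    by move/eqP: sum_m; rewrite sum_nat_eq0 => /forallP/(_ i).
  have -> : content [tuple] = 0 by apply/ffunP => i; rewrite !ffunE.
  by rewrite eqxx mul1n big1 // => i _; rewrite ffunE.
transitivity (\sum_i m i * k`!)%N; last by rewrite factS -sum_m big_distrl.
rewrite big_tupleS; apply: eq_bigr => i _.
case: (posnP (m i)) => [mi|/mnm_subK[m' def_m]].
  rewrite mi mul0n big1 // => t _; rewrite content_cons.
  by case: eqP => // /ffunP/(_ i); rewrite mnmD1E mi eqxx addn1.
rewrite def_m mnmD1E eqxx addn1 -(IH m').
  rewrite big_distrr /=; apply: eq_bigr => t _.
  by rewrite content_cons (inj_eq (@mnm_addIr _)) mfactS mulnCA.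
apply: succn_inj; rewrite -sum_m def_m -addn1.
have e : (1 = \sum_(j : I) (j == i))%N.
  by rewrite (bigD1 i) //= eqxx big1 // => j /negbTE ->.
rewrite [X in (_ + X)%N]e -big_split /=; apply: eq_bigr => j _.
by rewrite mnmD1E.
Qed.

(* [ninv] is an inverse of the positive integers in A, which need not be a
   field: in the application A is a Novikov ring. *)
Variable ninv : nat -> A.
Hypothesis ninvP : forall n, (0 < n)%N -> ninv n * n%:R = 1.

Definition symmetric_fun (F : seq I -> A) :=
  forall s s', perm_eq s s' -> F s = F s'.

Implicit Types F G : seq I -> A.

(** Grouping words by content: a single representative is kept, and 1/k! over all words of length k
    becomes 1/m!, as [egf_sum] shows. *)
Definition egf F : powser I A := fun m => ninv (mfact m) * F (listing m).

Lemma mfact_gt0 m : (0 < mfact m)%N.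
Proof. by apply: prodn_gt0 => i; exact: fact_gt0. Qed.

Lemma ninvMl a b : (0 < a)%N -> (0 < b)%N -> ninv (a * b) *+ a = ninv b.
Proof.
move=> a_gt0 b_gt0; rewrite -[LHS]mulr1 -(ninvP b_gt0) mulrCA mulrnAl -mulrnAr.
by rewrite -mulrnA mulnC ninvP ?mulr1 // muln_gt0 b_gt0.
Qed.

Lemma listing_content s : perm_eq (listing (content s)) s.
Proof. by rewrite -content_eq content_listing. Qed.

(** The factor m_i + 1 turns the inverse factorial of m + e_i into that of m, so deriving just
    inserts i. *)
Lemma pderiv_egf i F : symmetric_fun F ->
  pderiv i (egf F) = egf (fun s => F (i :: s)).
Proof.
move=> symF; apply/funext => m.
rewrite /pderiv /egf mfactS -mulrnAl ninvMl ?mfact_gt0 //.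
congr (_ * _); apply: symF.
by rewrite -content_eq content_cons !content_listing.
Qed.

Lemma symmetric_cons i F : symmetric_fun F -> symmetric_fun (fun s => F (i :: s)).
Proof. by move=> symF s s' ss'; apply: symF; rewrite perm_cons. Qed.

Lemma egf_content F s : symmetric_fun F ->
  F s = (mfact (content s))%:R * egf F (content s).
Proof.
move=> symF; rewrite mulrA [_ * ninv _]mulrC ninvP ?mfact_gt0 // mul1r.
by apply: symF; rewrite perm_sym listing_content.
Qed.

(** All k!/m! words of content m contribute the same value. *)
Lemma egf_sum F m (k := (\sum_i m i)%N) : symmetric_fun F ->
  egf F m = ninv k`! * \sum_(t : k.-tuple I | content t == m) F t.
Proof.
move=> symF; set N := (\sum_(t : k.-tuple I) (content t == m))%N.
have kE : (N * mfact m)%N = k`! by rewrite big_distrl /= card_content.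
have N_gt0 : (0 < N)%N.
  by move: (fact_gt0 k); rewrite -kE muln_gt0 => /andP[].
have -> : \sum_(t : k.-tuple I | content t == m) F t = F (listing m) *+ N.
  rewrite /N -sumrMnr big_mkcond; apply: eq_bigr => t _ /=.
  case: eqP => [<-|]; last by rewrite mulr0n.
  by rewrite mulr1n; apply: symF; rewrite perm_sym listing_content.
by rewrite mulrnAr -mulrnAl -kE ninvMl ?mfact_gt0.
Qed.

Lemma series0M f g : (f * g) 0 = f 0 * g 0.
Proof.
have m0 : (0, 0) \in splits (0 : {ffun I -> nat}) by rewrite mem_splits /= add0r.
rewrite seriesME (bigD1_seq _ m0 (splits_uniq _)) /=.
rewrite big_seq_cond big1 ?addr0// => -[x y] /andP[]; rewrite mem_splits /=.
move=> /eqP xy0; have [-> ->] : x = 0 /\ y = 0; last by rewrite eqxx.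
split; apply/ffunP => i; have /ffunP/(_ i)/eqP := xy0; rewrite !ffunE;
  by rewrite [_ == _](addn_eq0 (x i) (y i)) => /andP[/eqP xi0 /eqP yi0].
Qed.

(* Distributing the entries of s over two lists is the Leibniz rule for the
   iterated derivative of a product along s. *)
Lemma egf_mul_masks F G s : symmetric_fun F -> symmetric_fun G ->
  \sum_(B : (size s).-tuple bool) F (mask B s) * G (mask (map negb B) s) =
  (mfact (content s))%:R * (egf F * egf G) (content s).
Proof.
elim: s F G => [|i s IH] F G symF symG.
  rewrite big_tuple0 /=.
  have -> : content [::] = 0 by apply/ffunP => i; rewrite !ffunE.
  have e : (0 : {ffun I -> nat}) = content [::] by apply/ffunP => i; rewrite !ffunE.
  have f1 : mfact (content [::]) = 1%N by rewrite /mfact big1 // => i _; rewrite ffunE.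
  rewrite series0M e (egf_content [::] symF) (egf_content [::] symG) f1 !mul1r.
  by [].
rewrite big_tupleS big_bool /=.
rewrite (IH (fun s' => F (i :: s')) G) //; last exact: symmetric_cons.
rewrite (IH F (fun s' => G (i :: s'))) //; last exact: symmetric_cons.
rewrite -mulrDr -seriesDE -!pderiv_egf // -pderivM content_cons mfactS.
by rewrite /pderiv natrM -mulrA !mulr_natl mulrnAC.
Qed.
End PowerSeries.

(** * The genus-0 potential *)

Section Potential.
Variables (C : fieldType) (X : cohomology C).
Hypothesis char0 : forall n, n.+1%:R != 0 :> C.
Variables (W : gromov_witten X) (B : hodge_basis X).
Local Notation idx := 'I_(rk B).+1.
Local Notation fn := (sfun W B).
Local Notation nov := (novikov W).
Local Notation base a := (tnth (cls B) a).
Local Notation scal := (@scal _ X W B).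
Implicit Types (a b c x y z : idx) (f g : fn) (m : {ffun idx -> nat}).

Definition sderiv a : fn -> fn := @pderiv idx nov a.

Lemma sderivD a : {morph sderiv a : f g / f + g}.
Proof. exact: pderivD. Qed.
Lemma sderivM a f g : sderiv a (f * g) = sderiv a f * g + f * sderiv a g.
Proof. exact: pderivM. Qed.
Lemma sderivC a b f : sderiv a (sderiv b f) = sderiv b (sderiv a f).
Proof. exact: pderivC. Qed.

Lemma scalE s f m l : (scal s * f) m l = s * f m l.
Proof.
transitivity ((@series_const (effcone W) C s * f m : nov) l).
  rewrite /Defs.scal.
  by have -> := @series_constM {ffun idx -> nat} nov
    (@series_const (effcone W) C s) f m.
exact: series_constM.
Qed.

Fact scal_is_additive : zmod_morphism scal.
Proof. by move=> s t; rewrite /Defs.scal !rmorphB. Qed.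
Fact scal_is_multiplicative : monoid_morphism scal.
Proof. by split=> [|s t]; rewrite /Defs.scal ?rmorph1 // !rmorphM. Qed.
HB.instance Definition _ :=
  GRing.isZmodMorphism.Build C fn scal scal_is_additive.
HB.instance Definition _ :=
  GRing.isMonoidMorphism.Build C fn scal scal_is_multiplicative.

Lemma sderiv_scal a s : sderiv a (scal s) = 0.
Proof. exact: pderiv_const. Qed.

Definition ninv (n : nat) : nov := @series_const (effcone W) C n%:R^-1.

Lemma ninvP n : (0 < n)%N -> ninv n * n%:R = 1.
Proof.
move=> n_gt0; rewrite /ninv -(rmorph_nat (@series_const (effcone W) C)).
by rewrite -rmorphM mulVf ?rmorph1 //; case: n n_gt0.
Qed.

Lemma ninvE n (h : nov) l : (ninv n * h) l = n%:R^-1 * h l.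
Proof. exact: series_constM. Qed.

Definition corr (s : seq idx) : nov := @correlator _ _ W [seq base i | i <- s].

Lemma corr_sym : symmetric_fun corr.
Proof.
move=> s s' ss'; apply/funext => l; apply: GW_perm.
exact: perm_map.
Qed.

Lemma corr_sym3 a b c : symmetric_fun (fun s => corr [:: a, b, c & s]).
Proof.
exact: (symmetric_cons c (symmetric_cons b (symmetric_cons a corr_sym))).
Qed.

Lemma F0E : @F0 _ _ W B = egf ninv corr.
Proof.
by apply/funext => m; rewrite (egf_sum ninvP _ corr_sym).
Qed.

Definition F3 a b c : fn := sderiv a (sderiv b (sderiv c (@F0 _ _ W B))).

Lemma F3E a b c : F3 a b c = egf ninv (fun s => corr [:: c, b, a & s]).
Proof.
have sym1 := symmetric_cons c corr_sym.
have sym2 := symmetric_cons b sym1.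
rewrite /F3 /sderiv F0E (pderiv_egf ninvP c corr_sym).
by rewrite (pderiv_egf ninvP b sym1) (pderiv_egf ninvP a sym2).
Qed.

Lemma F3Cl a b c : F3 a b c = F3 b a c.
Proof. exact: sderivC. Qed.
Lemma F3Cr a b c : F3 a b c = F3 a c b.
Proof. by rewrite /F3 [sderiv b _]sderivC. Qed.

Lemma sderiv_F3 a b c x : sderiv a (F3 b c x) = sderiv b (F3 a c x).
Proof. by rewrite /F3 sderivC. Qed.

Lemma F3_coef a b c m l : F3 a b c m l =
  (mfact m)%:R^-1 * GW (curve_class W l)
    [:: base c, base b, base a & [seq base i | i <- listing m]].
Proof. by rewrite F3E /egf ninvE. Qed.

Lemma bracket3 (u v w : vfield W B) :
  <<( u ; v ; w )>> =
  \sum_a \sum_b \sum_c u 0 a * v 0 b * w 0 c * F3 a b c.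
Proof.
rewrite /bracket /= big_tupleS; apply: eq_bigr => a _.
rewrite big_tupleS; apply: eq_bigr => b _.
rewrite big_tupleS; apply: eq_bigr => c _.
rewrite big_tuple0 !big_ord_recl big_ord0 /= mulr1 !mulrA.
by rewrite !(tnth_nth ord0).
Qed.

Lemma bracket4 (u v w t : vfield W B) :
  <<( u ; v ; w ; t )>> = \sum_a \sum_b \sum_c \sum_x
    u 0 a * v 0 b * w 0 c * t 0 x * sderiv a (F3 b c x).
Proof.
rewrite /bracket /= big_tupleS; apply: eq_bigr => a _.
rewrite big_tupleS; apply: eq_bigr => b _.
rewrite big_tupleS; apply: eq_bigr => c _.
rewrite big_tupleS; apply: eq_bigr => x _.
rewrite big_tuple0 !big_ord_recl big_ord0 /= mulr1 !mulrA.
by rewrite !(tnth_nth ord0).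
Qed.

(** * Intersection form and WDVV equations *)

Local Notation metric := (Defs.eta B).
Local Notation cometric := (invmx (Defs.eta B)).

Lemma metricC a b : metric a b = metric b a.
Proof. by rewrite !mxE cupC. Qed.

Lemma base_sum (v : X) : v = \sum_b coord (cls B) b v *: base b.
Proof.
rewrite [LHS](coord_basis (cls_basis B) (memvf v)).
by apply: eq_bigr => b _; rewrite (tnth_nth 0).
Qed.

(** A vector in the kernel represents a class orthogonal to all of cohomology, which is zero by
    Poincare duality. *)
Lemma metric_unit : metric \in unitmx.
Proof.
rewrite -row_free_unit; apply: inj_row_free => v v_eta.
have orth (y : X) : integral X ((\sum_a v 0 a *: base a) * y) = 0.
  rewrite (base_sum y) mulr_sumr linear_sum big1 // => b _.
  rewrite -scalerAr linearZ /= mulr_suml linear_sum.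
  transitivity (coord (cls B) b y * (v *m metric) 0 b); last first.
    by rewrite v_eta mxE mulr0.
  congr (_ * _); rewrite mxE; apply: eq_bigr => a _.
  by rewrite -scalerAl linearZ /= !mxE.
apply/rowP => a; rewrite mxE.
have /freeP free_cls := basis_free (cls_basis B).
apply: (free_cls (fun a => v 0 a)); rewrite -[RHS](poincare orth).
by apply: eq_bigr => b _; rewrite (tnth_nth 0).
Qed.

Lemma cometricC a b : cometric a b = cometric b a.
Proof.
rewrite -[in LHS](_ : metric^T = metric) -?trmx_inv ?mxE //.
by apply/matrixP => x y; rewrite mxE metricC.
Qed.

Lemma GW0 L (s : seq X) : GW (g := W) L (0 :: s) = 0.
Proof.
have := GW_linear (g := W) L 1 0 0 s; rewrite scaler0 addr0 mul1r => /eqP.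
by rewrite eq_sym -subr_eq0 addrK => /eqP.
Qed.

Lemma GW_sum L (J : Type) (r : seq J) (k : J -> C) (v : J -> X) (s : seq X) :
  GW (g := W) L (\sum_(j <- r) k j *: v j :: s) =
  \sum_(j <- r) k j * GW (g := W) L (v j :: s).
Proof.
elim: r => [|j r IH]; first by rewrite !big_nil GW0.
by rewrite !big_cons GW_linear IH.
Qed.

Lemma fn_sumE (J : Type) (r : seq J) (h : J -> fn) m l :
  (\sum_(j <- r) h j) m l = \sum_(j <- r) h j m l.
Proof.
transitivity ((\sum_(j <- r) h j m : nov) l); last exact: series_sumE.
by have -> := @series_sumE {ffun idx -> nat} nov _ r h m.
Qed.

Lemma egfM_coef F G m l : symmetric_fun F -> symmetric_fun G ->
  (egf ninv F * egf ninv G : fn) m l = (mfact m)%:R^-1 *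
  \sum_(T : (size (listing m)).-tuple bool) \sum_(u <- splits l)
    F (mask T (listing m)) u.1 * G (mask (map negb T) (listing m)) u.2.
Proof.
move=> symF symG; have := egf_mul_masks ninvP (listing m) symF symG.
rewrite content_listing => e.
have -> : (egf ninv F * egf ninv G : fn) m = ninv (mfact m) *
    ((mfact m)%:R * (egf ninv F * egf ninv G : fn) m).
  by rewrite mulrA ninvP ?mul1r ?mfact_gt0.
rewrite -e ninvE; congr (_ * _).
exact: series_sumE.
Qed.

(** Transports a sum between tuple types whose lengths are only provably equal, here those of
    [listing m] and of its image in cohomology. *)
Lemma eq_big_tuple_size n n' (F : seq bool -> C) : n = n' ->
  \sum_(T : n.-tuple bool) F T = \sum_(T : n'.-tuple bool) F T.
Proof. by move->. Qed.

(** At each coefficient this is [GW_wdvv] with the insertions listed by m: distributing them over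
    two factors is multiplication of generating series, and [cometric] supplies the dual basis. *)
Lemma wdvv a b c x :
  \sum_y \sum_z scal (cometric y z) * (F3 a b y * F3 z c x) =
  \sum_y \sum_z scal (cometric y z) * (F3 a c y * F3 z b x).
Proof.
apply/funext => m; apply/funext => l.
pose s := [seq base i | i <- listing m].
pose dual i := \sum_z cometric z i *: base z.
have dim_eq : (rk B).+1 = \dim {:X}.
  by rewrite (size_basis (cls_basis B)).
have dualP i j : integral X (base i * dual j) = (i == j)%:R.
  transitivity ((metric *m cometric) i j).
    rewrite /dual mulr_sumr linear_sum mxE; apply: eq_bigr => z _.
    by rewrite -scalerAr linearZ /= mulrC !mxE.
  by rewrite mulmxV ?metric_unit // mxE.
have := GW_wdvv (g := W) l s dim_eq dualP (base a) (base b) (base c) (base x).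
rewrite /=.
suff main b' c' : (\sum_y \sum_z scal (cometric y z) * (F3 a b' y * F3 z c' x)) m l =
    (mfact m)%:R^-1 * \sum_(u <- splits l) \sum_(T : (size s).-tuple bool) \sum_i
        GW (g := W) (curve_class W u.1) ([:: base a; base b'; base i] ++ mask T s) *
        GW (g := W) (curve_class W u.2)
          ([:: dual i; base c'; base x] ++ mask (map negb T) s).
  move=> e.
  apply: etrans (main b c) _.
  apply: etrans _ (esym (main c b)).
  congr (_ * _).
  exact: e.
rewrite fn_sumE.
transitivity (\sum_y \sum_z cometric y z * ((mfact m)%:R^-1 *
  \sum_(T : (size s).-tuple bool) \sum_(u <- splits l)
    (GW (g := W) (curve_class W u.1) ([:: base a; base b'; base y] ++ mask T s) *
     GW (g := W) (curve_class W u.2)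
       ([:: base z; base c'; base x] ++ mask (map negb T) s)))).
  apply: eq_bigr => y _; rewrite fn_sumE; apply: eq_bigr => z _.
  rewrite scalE !F3E (egfM_coef _ _ (corr_sym3 _ _ _) (corr_sym3 _ _ _)).
  congr (_ * (_ * _)).
  rewrite (@eq_big_tuple_size (size s) (size (listing m))
    (fun T => \sum_(u <- splits l)
     (GW (g := W) (curve_class W u.1) ([:: base a; base b'; base y] ++ mask T s) *
     GW (g := W) (curve_class W u.2)
       ([:: base z; base c'; base x] ++ mask (map negb T) s)))) ?size_map //.
  apply: eq_bigr => T _; apply: eq_bigr => u _.
  rewrite /corr /correlator /= !map_mask -/s.
  congr (_ * _); apply: GW_perm; apply/permP => p /=; ring.
(* The axiom sums over splittings of the class, then over distributions, then over dual pairs; what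
   remains is exchanging sums and expanding [dual] by linearity. *)
under eq_bigr do [under eq_bigr do rewrite mulrCA; rewrite -mulr_sumr].
rewrite -mulr_sumr; congr (_ * _).
under eq_bigr do under eq_bigr do rewrite mulr_sumr.
under eq_bigr do rewrite exchange_big /=.
rewrite exchange_big [RHS]exchange_big; apply: eq_bigr => T _ /=.
under eq_bigr do under eq_bigr do rewrite mulr_sumr.
under eq_bigr do rewrite exchange_big /=.
rewrite exchange_big; apply: eq_bigr => u _ /=.
apply: eq_bigr => y _; rewrite GW_sum mulr_sumr; apply: eq_bigr => z _.
by rewrite cometricC mulrCA.
Qed.

Lemma listing_nil m : (listing m == [::]) = (m == 0).
Proof.
apply/eqP/eqP => [m0|->].
  by rewrite -[m]content_listing m0; apply/ffunP => i; rewrite !ffunE.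
rewrite /listing; elim: (enum _) => //= i s ->.
by rewrite ffunE.
Qed.

(** A nonzero class kills an identity insertion, and in class zero only three insertions survive; so
    the series is constant. *)
Lemma F3_unit a b : F3 ord0 a b = scal (metric a b).
Proof.
apply/funext => m; apply/funext => l; rewrite F3_coef.
rewrite (_ : GW _ _ = GW (g := W) (curve_class W l)
  (1 :: base b :: base a :: [seq base i | i <- listing m])); last first.
  by apply: GW_perm; apply/permP => p /=; rewrite cls1; ring.
transitivity (if (m == 0) && (l == 0) then metric a b else 0); last first.
  by rewrite /Defs.scal /series_const; case: (m == 0); case: (l == 0).
case: (eqVneq l 0) => [->|l0]; last first.
  rewrite andbF GW_unit ?mulr0 // -(raddf0 (curve_class W)).
  by rewrite (inj_eq (@curve_class_inj _ _ W)).
rewrite andbT raddf0 GW_point -listing_nil; case: eqP => [e|].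
  rewrite e /= (_ : mfact m = 1%N) ?invr1 ?mul1r; last first.
    have /eqP -> : m == 0 by rewrite -listing_nil e.
    by rewrite /mfact big1 // => i _; rewrite ffunE.
  by rewrite mxE cupC.
by case: (listing m) => // i s _ /=; rewrite mulr0.
Qed.

(** * Hodge degrees and homogeneity *)

(** The basis only records some type containing the identity. Independence of the Hodge summands
    forces it to be (0,0), as the identity is nonzero. *)
Lemma pdeg_unit : @pdeg _ _ B ord0 = 0%N.
Proof.
have u00 : (1 : X) \in hodge X 0 0 by rewrite hodge_unit memv_line.
have := @cls_hodge _ _ B ord0; rewrite cls1 => u1.
case: (leqP (@pdeg _ _ B ord0) (dimX X)) => [lep|gtp]; last first.
  by move: u1; rewrite hodge_bound ?gtp // memv0 oner_eq0.
case: (leqP (@qdeg _ _ B ord0) (dimX X)) => [leq|gtq]; last first.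
  by move: u1; rewrite hodge_bound ?gtq ?orbT // memv0 oner_eq0.
pose o : 'I_(dimX X).+1 * 'I_(dimX X).+1 := (ord0, ord0).
pose i : 'I_(dimX X).+1 * 'I_(dimX X).+1 :=
  (inord (@pdeg _ _ B ord0), inord (@qdeg _ _ B ord0)).
have hi : hodge X i.1 i.2 = hodge X (@pdeg _ _ B ord0) (@qdeg _ _ B ord0).
  by rewrite /= !inordK.
have [/(congr1 (fun u => val u.1))|io] := eqVneq i o; first by rewrite /= inordK.
have /directv_sumP/(_ o isT) cap0 := hodge_direct X.
have : (1 : X) \in (hodge X o.1 o.2 :&: \sum_(j | j != o) hodge X j.1 j.2)%VS.
  rewrite memv_cap u00 /=.
  by apply: (subvP (sumv_sup i io (subvv _))); rewrite hi.
by rewrite cap0 memv0 oner_eq0.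
Qed.

(** A nonzero pairing forces p_a + p_b = d, hence b_a + b_b = d - (d - 1) = 1. *)
Lemma metric_grading a b : (bdeg a + bdeg b) * metric a b = metric a b.
Proof.
have [->|nz] := eqVneq (metric a b) 0; first by rewrite mulr0.
suff -> : bdeg a + bdeg b = 1 by rewrite mul1r.
have := hodge_cup (@cls_hodge _ _ B a) (@cls_hodge _ _ B b) => /integral_top top_deg.
have [[e _]|/top_deg] := eqVneq
  (@pdeg _ _ B a + @pdeg _ _ B b, @qdeg _ _ B a + @qdeg _ _ B b)%N
  (dimX X, dimX X).
  by rewrite /bdeg -e natrD; field; exact: (char0 1).
by move=> e; move: nz; rewrite mxE e eqxx.
Qed.

Lemma big_listing (V : nmodType) (h : idx -> V) m :
  \sum_(i <- listing m) h i = \sum_i h i *+ m i.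
Proof.
rewrite /listing big_flatten big_map big_enum /=; apply: eq_bigr => i _.
by rewrite big_nseq iter_addr_0.
Qed.

Lemma size_listing m : size (listing m) = (\sum_i m i)%N.
Proof.
rewrite -sum1_size big_listing; apply: eq_bigr => i _.
by rewrite -[RHS]muln1 -mulr_natl natn.
Qed.

Lemma sderiv_F3_coef a b c x m l : sderiv a (F3 b c x) m l =
  (mfact m)%:R^-1 * GW (g := W) (curve_class W l)
    [:: base x, base c, base b, base a & [seq base i | i <- listing m]].
Proof.
by rewrite F3E /sderiv (pderiv_egf ninvP a (corr_sym3 _ _ _)) /egf ninvE.
Qed.

(** Extends the divisor axiom to class zero, where both sides vanish: the pairing is additive in the
    class, and invariants with more than three insertions are zero there. *)
Lemma GW_chern1 L (s : seq X) : (3 <= size s)%N ->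
  GW (g := W) L (chern X 1 :: s) = pairing (g := W) L (chern X 1) * GW (g := W) L s.
Proof.
move=> s3; have [->|L0] := eqVneq L 0; last first.
  by apply: GW_divisor L0 (chern_hodge X 1) _.
rewrite GW_point; case: s s3 => [|u [|v [|w s]]] //= _.
have p0 : pairing (g := W) 0 (chern X 1) =
    pairing (g := W) 0 (chern X 1) + pairing (g := W) 0 (chern X 1).
  by rewrite -{1}(addr0 (0 : H2 W)) pairingD lfunE.
by rewrite -[pairing _ _](addrK (pairing (g := W) 0 (chern X 1))) -p0 subrr mul0r.
Qed.

(** The dimension axiom in the first Hodge degree. As p_1 = 0, the weight b_1 + 1 - b_a is 1 -
    p_a. *)
Lemma degree_count a x y m l (L := curve_class W l) :
  GW (g := W) L [:: base y, base x, base a & [seq base i | i <- listing m]] != 0 ->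
  pairing (g := W) L (chern X 1) + \sum_b (bdeg (B := B) ord0 + 1 - bdeg b) *+ m b =
  bdeg a + bdeg x + bdeg y - (bdeg (B := B) ord0 + 1).
Proof.
pose pq := [seq (@pdeg _ _ B i, @qdeg _ _ B i) | i <- [:: y, x, a & listing m]].
have all_pq : all2 (fun (v : X) u => v \in hodge X u.1 u.2)
    [seq base i | i <- [:: y, x, a & listing m]] pq.
  rewrite /pq; elim: [:: y, x, a & listing m] => //= i s ->.
  by rewrite cls_hodge.
move=> /(GW_dimension all_pq)[]; rewrite big_map /= !big_cons big_listing => e _.
have -> : pairing (g := W) L (chern X 1) = (pdeg y)%:R + ((pdeg x)%:R +
    ((pdeg a)%:R + \sum_i (pdeg i)%:R *+ m i)) - (dimX X)%:R - (\sum_i m i)%:R.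
  rewrite e size_map size_listing -[(_.+3)%:R]/((3 + _)%:R) natrD; ring.
have -> : \sum_b (bdeg (B := B) ord0 + 1 - bdeg b) *+ m b =
    (\sum_i m i)%:R - \sum_i (@pdeg _ _ B i)%:R *+ m i.
  rewrite natr_sum -sumrB; apply: eq_bigr => i _.
  rewrite /bdeg pdeg_unit -mulr_natl -[(pdeg i)%:R *+ _]mulr_natl.
  by field; exact: (char0 1).
by rewrite /bdeg pdeg_unit; field; exact: (char0 1).
Qed.

(** On each coefficient the c_1 part of E acts through the divisor axiom and the linear part through
    the operators t^b d_b. The total weight is fixed by [degree_count] unless the invariant
    vanishes. *)
Lemma homogeneity a x y :
  \sum_b euler W B 0 b * sderiv b (F3 a x y) =
  scal (bdeg a + bdeg x + bdeg y - (bdeg (B := B) ord0 + 1)) * F3 a x y.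
Proof.
apply/funext => m; apply/funext => l; rewrite fn_sumE scalE F3_coef.
set T := [:: _, _, _ & _].
transitivity (\sum_b (coord (cls B) b (chern X 1) *
    ((mfact m)%:R^-1 * GW (g := W) (curve_class W l) (base b :: T)) +
    (bdeg (B := B) ord0 + 1 - bdeg b) *
    ((mfact m)%:R^-1 * GW (g := W) (curve_class W l) T *+ m b))).
  apply: eq_bigr => b _; rewrite mxE mulrDl.
  transitivity ((scal (coord (cls B) b (chern X 1)) * sderiv b (F3 a x y)) m l +
    (scal (bdeg (B := B) ord0 + 1 - bdeg b) *
      ((@pvar idx nov b : fn) * sderiv b (F3 a x y))) m l).
    by rewrite mulrA.
  rewrite !scalE sderiv_F3_coef; congr (_ * (_ * _) + _ * _).
    by apply: GW_perm; apply/permP => p /=; ring.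
  have -> := @pvar_pderiv idx nov b (F3 a x y) m.
  rewrite -F3_coef; exact: seriesMnE.
rewrite big_split /=.
under eq_bigr do rewrite mulrCA.
rewrite -mulr_sumr -GW_sum -base_sum GW_chern1 //.
under [X in _ + X]eq_bigr do rewrite mulrnAr -mulrnAl.
rewrite -mulr_suml [_^-1 * (_ * _)]mulrCA -mulrDl.
have [->|/degree_count ->] := eqVneq (GW (g := W) (curve_class W l) T) 0.
  by rewrite !mulr0.
by [].
Qed.
End Potential.

(** * The genus-1 derivative *)

(** Phi_0 and Phi_1 are constants defined separately, so for k < 2 the right-hand side has to
    vanish. *)
Lemma low_degree_sums (S : comNzRingType) (f1 f2 f3 f4 f5 f6 : nat -> S) x k :
  (k < 2)%N ->
  - (\sum_(1 <= i < k) f1 i) - (\sum_(0 <= i < k.-1) f2 i)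
    + (\sum_(0 <= i < k.-1) f3 i) - (\sum_(1 <= i < k) f4 i)
    - (\sum_(1 <= i < k) f5 i) + 12%:R * (\sum_(1 <= i < k) f6 i)
    - (k * (k - 1))%:R * x = 0.
Proof.
move=> k_lt2; have -> : (k * (k - 1) = 0)%N by lia.
have k0 : (k.-1 <= 0)%N by lia.
rewrite !big_geq //.
by rewrite mulr0 mul0r !(oppr0, addr0).
Qed.

Section Genus1.
Variables (C : fieldType) (X : cohomology C).
Hypothesis char0 : forall n, n.+1%:R != 0 :> C.
Variables (W : gromov_witten X) (B : hodge_basis X).
Local Notation idx := 'I_(rk B).+1.
Local Notation fn := (sfun W B).
Local Notation scal := (@scal _ X W B).
Local Notation metric := (Defs.eta B).
Local Notation cometric := (invmx (Defs.eta B)).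
Implicit Types (a b c x y : idx).

Lemma sderiv_euler a b : sderiv a (euler W B 0 b) =
  (a == b)%:R * (scal (bdeg (B := B) ord0) + 1 - scal (bdeg b)).
Proof.
pose t : fn := @pvar idx (novikov W) b.
have -> : euler W B 0 b = scal (coord (cls B) b (chern X 1)) +
    scal (bdeg (B := B) ord0 + 1 - bdeg b) * t by rewrite mxE.
have dt : sderiv a t = (a == b)%:R by exact: pderiv_pvar.
(* The coordinate is made opaque, so that rewriting sees only its derivative. *)
move: t dt => t dt.
rewrite sderivD sderivM !sderiv_scal dt add0r mul0r add0r.
by rewrite mulrC rmorphB rmorphD rmorph1.
Qed.

Lemma dirder_glow a (f : fn) : dirder (glow a) f = sderiv a f.
Proof.
rewrite /dirder (bigD1 a) //= [X in _ + X]big1 ?addr0.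
  by rewrite mxE !eqxx mul1r.
by move=> b /negbTE nb; rewrite mxE eqxx nb mul0r.
Qed.

(** The weights are 24/24, 24/4 and 24K/12. *)
Lemma Phi_scaled k (E := Epow (W := W) (B := B)) (K := k.+2) :
  24%:R * Phi W B K =
  - (\sum_(0 <= m < K) \sum_x \sum_y \sum_z
       scal (bdeg x) * <<( glow ord0 ; E m ; gup x )>>
                     * <<( glow x ; E (K - 1 - m)%N ; gup y )>>
                     * <<( glow y ; glow z ; gup z )>>)
  - 6%:R * (\sum_(0 <= m < K) \sum_x \sum_y
       scal (bdeg x) * scal (bdeg y) * <<( glow x ; E m ; gup y )>>
                                     * <<( glow y ; E (K - 1 - m)%N ; gup x )>>)
  + (2 * K)%:R * (\sum_x <<( glow x ; E (K - 1)%N ; gup x )>>).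
Proof.
rewrite /Phi -/E.
set S1 := \sum_(0 <= m < _) _; set S2 := \sum_(0 <= m < _) _; set S3 := \sum_c _.
have h24 : 24%:R * scal 24^-1 = 1.
  by rewrite -(rmorph_nat scal) -rmorphM mulfV ?rmorph1 // (char0 23).
have h4 : 24%:R * scal 4^-1 = 6%:R.
  by rewrite -!(rmorph_nat scal) -rmorphM; congr (scal _); field; exact: (char0 3).
have hK : 24%:R * scal (K%:R / 12%:R) = (2 * K)%:R.
  rewrite -!(rmorph_nat scal) -rmorphM natrM; congr (scal _).
  by field; exact: (char0 11).
rewrite mulrDr mulrBr mulNr mulrN !mulrA h24 h4 hK mul1r.
by [].
Qed.

Definition gram : 'M[fn]_((rk B).+1) := map_mx scal metric.
Definition cogram : 'M[fn]_((rk B).+1) := map_mx scal cometric.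

Lemma gram_sym : gram^T = gram.
Proof.
apply/matrixP => a b; rewrite mxE [LHS]mxE [RHS]mxE.
by congr (scal _); exact: metricC.
Qed.

Lemma mul_cogram_gram : cogram *m gram = 1%:M.
Proof. by rewrite -map_mxM mulVmx ?metric_unit // map_mx1. Qed.

Lemma sderiv_cogram a b c : sderiv a (cogram b c) = 0.
Proof. by rewrite mxE sderiv_scal. Qed.

Lemma cogram_wdvv a b c x :
  \sum_y \sum_z cogram y z * (@F3 _ _ W B a b y * F3 z c x) =
  \sum_y \sum_z cogram y z * (F3 a c y * F3 z b x).
Proof.
have cogramE (f : idx -> idx -> fn) :
    \sum_y \sum_z cogram y z * f y z =
    \sum_y \sum_z scal (cometric y z) * f y z.
  by apply: eq_bigr => y _; apply: eq_bigr => z _; rewrite mxE.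
exact: etrans (cogramE _) (etrans (wdvv char0 W a b c x) (esym (cogramE _))).
Qed.

Lemma F3_gram a b : F3 ord0 a b = gram a b.
Proof. by rewrite (F3_unit char0) [RHS]mxE. Qed.

Lemma scal_bdeg_gram a b :
  (scal (bdeg a) + scal (bdeg b)) * gram a b = gram a b.
Proof. by rewrite [gram a b]mxE -rmorphD -rmorphM (metric_grading char0). Qed.

Lemma scal_homogeneity a x y :
  \sum_b euler W B 0 b * sderiv b (F3 a x y) =
  (scal (bdeg a) + scal (bdeg x) + scal (bdeg y) -
   (scal (bdeg (B := B) ord0) + 1)) * F3 a x y.
Proof. by rewrite (homogeneity char0) rmorphB !rmorphD rmorph1. Qed.

Lemma gup_cogram a : gup a = \row_b cogram b a :> 'rV[fn]_((rk B).+1).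
Proof. by apply/rowP => b; rewrite !mxE. Qed.

Theorem genus1_derivative k (alpha : idx) :
  let E (j : nat) : vfield W B := Epow j in
  let D : vfield W B := Delta in
  let ga : vfield W B := glow alpha in
  24%:R * dirder ga (Phi W B k) =
    - (\sum_(1 <= i < k) \sum_mu
         <<( Gop (E i) ; E (k - i - 1)%N \oq ga ; glow mu ; gup mu )>>)
    - (\sum_(0 <= i < k.-1)
         (k - i - 1)%:R * <<( Gop (E i) \oq E (k - i - 2)%N ; D ; ga )>>)
    + (\sum_(0 <= i < k.-1)
         ((2 * i + 2)%:R - k%:R) *
         <<( Gop (D \oq E (k - i - 2)%N) ; E i ; ga )>>)
    - (\sum_(1 <= i < k) \sum_(1 <= j < i.+1)
         <<( Gop (E (k - i - 1)%N \oq D) ; Gop (E (i - j)%N \oq ga) ;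
             E j.-1 )>>)
    - (\sum_(1 <= i < k) \sum_(1 <= j < i.+1)
         <<( Gop (E (k - i - 1)%N) \oq D ; Gop (E (i - j)%N \oq ga) ;
             E j.-1 )>>)
    + 12%:R * (\sum_(1 <= i < k) i%:R * \sum_mu
         <<( Gop (E (k - i - 1)%N \oq gup mu) \oq Gop (glow mu) ;
             E i.-1 ; ga )>>)
    - (k * (k - 1))%:R * <<( D ; E (k - 2)%N ; ga )>>.
Proof.
move=> E D ga; rewrite dirder_glow.
have low_degree : (k < 2)%N -> sderiv alpha (Phi W B k) = 0.
  case: k => [|[|]] // _; last exact: sderiv_scal.
  exact: (derivation0 (@sderivD _ _ _ _)).
case: (ltnP k 2) low_degree => [|k_ge2 _].
  move=> k_lt2 /(_ isT) ->; rewrite mulr0.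
  exact: esym (low_degree_sums _ _ _ _ _ _ _ k_lt2).
rewrite -(derivation_natmul (@sderivD _ _ _ _)).
case: k k_ge2 => [|[|k]] // _; rewrite Phi_scaled.
(* The hypotheses on [qprod], [Gop], [Epow] and [Delta] hold by definition, hence the instances of
   [erefl]. *)
have := @d_genus1_potential fn (rk B) (@sderiv _ _ W B) (@sderivD _ _ W B)
  (@sderivM _ _ W B) (@F3 _ _ W B) (@F3Cl _ _ W B) (@F3Cr _ _ W B)
  (@sderiv_F3 _ _ W B) gram cogram gram_sym mul_cogram_gram sderiv_cogram
  cogram_wdvv F3_gram (fun a => scal (bdeg a))
  (fun a b => sderiv_scal W a (bdeg b)) scal_bdeg_gram
  (euler W B) sderiv_euler scal_homogeneity
  (fun u v w => <<( u ; v ; w )>>) (fun u v w t => <<( u ; v ; w ; t )>>)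
  qprod Gop gup (@Epow _ _ W B) Delta
  (@bracket3 _ _ W B) (@bracket4 _ _ W B) (fun v w => erefl) (fun v => erefl)
  gup_cogram erefl (fun k => erefl) erefl alpha k.+2 isT.
by [].
Qed.
End Genus1.

Theorem theorem3p3 (R : realType) (X : cohomology R[i])
    (W : gromov_witten X) (B : hodge_basis X)
    (k : nat) (alpha : 'I_(rk B).+1) :
  let E (j : nat) : vfield W B := Epow j in
  let D : vfield W B := Delta in
  let ga : vfield W B := glow alpha in
  24%:R * dirder ga (Phi W B k) =
    - (\sum_(1 <= i < k) \sum_mu
         <<( Gop (E i) ; E (k - i - 1)%N \oq ga ; glow mu ; gup mu )>>)
    - (\sum_(0 <= i < k.-1)
         (k - i - 1)%:R * <<( Gop (E i) \oq E (k - i - 2)%N ; D ; ga )>>)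
    + (\sum_(0 <= i < k.-1)
         ((2 * i + 2)%:R - k%:R) *
         <<( Gop (D \oq E (k - i - 2)%N) ; E i ; ga )>>)
    - (\sum_(1 <= i < k) \sum_(1 <= j < i.+1)
         <<( Gop (E (k - i - 1)%N \oq D) ; Gop (E (i - j)%N \oq ga) ;
             E j.-1 )>>)
    - (\sum_(1 <= i < k) \sum_(1 <= j < i.+1)
         <<( Gop (E (k - i - 1)%N) \oq D ; Gop (E (i - j)%N \oq ga) ;
             E j.-1 )>>)
    + 12%:R * (\sum_(1 <= i < k) i%:R * \sum_mu
         <<( Gop (E (k - i - 1)%N \oq gup mu) \oq Gop (glow mu) ;
             E i.-1 ; ga )>>)
    - (k * (k - 1))%:R * <<( D ; E (k - 2)%N ; ga )>>.
Proof.
by apply: genus1_derivative => n; rewrite Num.Theory.pnatr_eq0.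
Qed.
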